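(* The projective tangent cone $\mathbb{P}T_0(X_{4,4})$ of $X_{4,4}$ at its singular point $0$ is non-reduced.
   Context: Base field $\mathbb{C}$. Let $\omega = e^{\pi i/12}$, $\sigma = e^{2\pi i/3}$, and let $G_5\subset \mathrm{GL}_2(\mathbb{C})$ be the (finite) complex reflection group generated by $$a=\begin{pmatrix} i&0\\0&-i\end{pmatrix},\quad b=\begin{pmatrix}0&1\\-1&0\end{pmatrix},\quad c=\frac{\omega}{\sqrt2}\begin{pmatrix}1&-1\\ i&i\end{pmatrix},\quad d=\begin{pmatrix}\sigma&0\\0&\sigma\end{pmatrix}.$$ $G_5$ acts on $V=\mathbb{C}^2$ and hence on $W=T^*V=V\oplus V^*\cong\mathbb{C}^4$, where $A\in G_5$ acts by $\mathrm{diag}(A,A^{-T})$, preserving the natural symplectic form. Let $x,y$ be the coordinates on $V$ and $X,Y$ the dual coordinates on $V^*$, so $\mathbb{C}[W]=\mathbb{C}[x,y,X,Y]$ and $\mathbb{C}^4/G_5=W/G_5=\mathrm{Spec}\,\mathbb{C}[W]^{G_5}$. Let $I\subset\mathbb{C}[W]^{G_5}$ be the radical ideal of the singular locus of $W/G_5$ (the image of the points of $W$ with non-trivial stabiliser in $G_5$), and let $\pi_I:S_I=\mathrm{Proj}\bigoplus_{n\ge0}I^n\to W/G_5$ be the blow-up at $I$. Put $$G_{2,2}=x^2X^2+i\sqrt3\,x^2Y^2+i\sqrt3\,y^2X^2+y^2Y^2-4xyXY,$$ let $\overline{G_{2,2}}$ be the polynomial obtained by complex conjugating its coefficients, and let $R_{4,4}=G_{2,2}\overline{G_{2,2}}\in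 I$. The affine chart $X_{4,4}\subseteq S_I$ is the open subset where the projective coordinate corresponding to $R_{4,4}$ is non-zero, i.e. $X_{4,4}=\mathrm{Spec}\,\mathbb{C}[W]^{G_5}\left[\tfrac{r}{R_{4,4}}: r\in I\right]$, the ring being taken inside $\mathbb{C}(x,y,X,Y)$. It is graded by total degree ($x,y,X,Y$ of degree 1), with only non-negative degrees and with degree-zero part $\mathbb{C}$; the origin $0\in X_{4,4}$ is the point whose maximal ideal is spanned by the homogeneous elements of positive degree. It is the unique singular point of $X_{4,4}$. For an affine variety $Z$ with coordinate ring $R$ and a point $z\in Z$ with maximal ideal $\mathfrak m\subset R$, the projective tangent cone is $\mathbb{P}T_z(Z)=\mathrm{Proj}\big(\bigoplus_{i\ge0}\mathfrak m^i/\mathfrak m^{i+1}\big)$. *)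

(* Defs.v *)
From HB Require Import structures.
From mathcomp Require Import all_boot all_order all_algebra.
From mathcomp Require Import generic_quotient ring_quotient fraction.
From mathcomp Require Import boolp classical_sets reals.
From mathcomp Require trigo.
From mathcomp Require Import complex.
From mathcomp Require Import mpoly.
From mathcomp Require Import ring.

Set Implicit Arguments.
Unset Strict Implicit.
Unset Printing Implicit Defensive.

Import Order.TTheory GRing.Theory Num.Theory.
Local Open Scope classical_set_scope.
Local Open Scope ring_scope.
Local Open Scope quotient_scope.

Definition is_reduced (A : pzRingType) : Prop :=
  forall (x : A) (n : nat), x ^+ n = 0 -> x = 0.

Section Ideals.
Variable R : comPzRingType.
Implicit Types A G m p : set R.

Definition is_ideal A : Prop :=
  [/\ A 0, forall x y, A x -> A y -> A (x + y)
    & forall a x, A x -> A (a * x)].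

Definition ideal_span G : set R := smallest is_ideal G.

(* The n-th power of the ideal generated by m, so m is not
   required to be an ideal beforehand. *)
Definition ideal_exp m (n : nat) : set R :=
  ideal_span
    [set \prod_(i < n) f i | f in [set f : 'I_n -> R | forall i, m (f i)]].

Definition is_prime p : Prop :=
  [/\ is_ideal p, ~ p 1 & forall x y, p (x * y) -> p x \/ p y].

Lemma ideal_span_ideal G : is_ideal (ideal_span G).
Proof.
split.
- by move=> A [[A0 _ _] _].
- move=> x y Gx Gy A AP; case: (AP) => -[_ AD _] _.
  by apply: AD; [apply: Gx|apply: Gy].
- by move=> a x Gx A AP; case: (AP) => -[_ _ AM] _; apply: AM; apply: Gx.
Qed.

Lemma ideal_span_min G A : is_ideal A -> G `<=` A -> ideal_span G `<=` A.
Proof. by move=> iA GA x; apply. Qed.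

Lemma ideal_span_sub G : G `<=` ideal_span G.
Proof. by move=> x Gx A [_]; apply. Qed.

Lemma ideal_opp A x : is_ideal A -> A x -> A (- x).
Proof. by case=> _ _ AM Ax; rewrite -mulN1r; apply: AM. Qed.

Lemma ideal_sub A x y : is_ideal A -> A x -> A y -> A (x - y).
Proof.
by move=> iA Ax Ay; case: (iA) => _ AD _; apply: AD => //; exact: ideal_opp.
Qed.

Lemma ideal_sum A (I : finType) (P : pred I) (F : I -> R) :
  is_ideal A -> (forall i, P i -> A (F i)) -> A (\sum_(i | P i) F i).
Proof. by case=> A0 AD _ AF; elim/big_ind: _. Qed.

Lemma ideal_exp_ideal m n : is_ideal (ideal_exp m n).
Proof. exact: ideal_span_ideal. Qed.

Lemma ideal_exp0 m x : ideal_exp m 0 x.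
Proof.
rewrite -[x]mulr1; have [_ _] := ideal_exp_ideal m 0; apply.
apply: ideal_span_sub; exists (fun=> 1); last by rewrite big_ord0.
by case.
Qed.

Lemma ideal_expD m i j x y :
  ideal_exp m i x -> ideal_exp m j y -> ideal_exp m (i + j) (x * y).
Proof.
move=> mx my.
pose A := [set a | forall b, ideal_exp m j b -> ideal_exp m (i + j) (a * b)].
have [e0 eD eM] := ideal_exp_ideal m (i + j).
have iA : is_ideal A.
  split=> [b _|a a' Aa Aa' b jb|a a' Aa b jb]; first by rewrite mul0r.
    by rewrite mulrDl; apply: eD; [apply: Aa|apply: Aa'].
  by rewrite -mulrA; apply: eM; apply: Aa.
apply: (ideal_span_min iA _ mx) => // _ [f mf <-] b.
pose B := [set b | ideal_exp m (i + j) (\prod_(k < i) f k * b)].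
suff iB : is_ideal B.
  apply: (ideal_span_min iB) => _ [g mg <-]; rewrite /B /=.
  apply: ideal_span_sub.
  exists (fun k => match split k with inl k => f k | inr k => g k end).
    by move=> k /=; case: (split k).
  rewrite big_split_ord /=; congr (_ * _); apply: eq_bigr => k _.
    by rewrite (unsplitK (inl k)).
  by rewrite (unsplitK (inr k)).
split=> [|a a' Ba Ba'|a a' Ba]; rewrite /B /=; first by rewrite mulr0.
  by rewrite mulrDr; apply: eD.
by rewrite mulrCA; apply: eM.
Qed.

End Ideals.

Record gradedRing := GradedRing {
  gr_sort :> comPzRingType;
  hpart : nat -> set gr_sort;
  hpart0 : forall d, hpart d 0;
  hpartB : forall d x y, hpart d x -> hpart d y -> hpart d (x - y);
  hpart1 : hpart 0 1;
  hpartM : forall d e x y, hpart d x -> hpart e y -> hpart (d + e) (x * y);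
  hpart_sum : forall x, exists n (c : 'I_n -> gr_sort),
    (forall i : 'I_n, hpart i (c i)) /\ x = \sum_i c i;
  hpart_direct : forall n (c : 'I_n -> gr_sort),
    (forall i : 'I_n, hpart i (c i)) -> \sum_i c i = 0 -> forall i, c i = 0
}.

Section Proj.
Variable S : gradedRing.

Definition is_homog (x : S) : Prop := exists d, hpart d x.

Definition is_homog_ideal (p : set S) : Prop :=
  is_ideal p /\ p = ideal_span (p `&` is_homog).

Definition irrelevant_ideal : set S :=
  ideal_span [set x | exists2 d, (0 < d)%N & hpart d x].

Record Proj := ProjPoint {
  proj_ideal :> set S;
  _ : is_prime proj_ideal;
  _ : is_homog_ideal proj_ideal;
  _ : ~ (irrelevant_ideal `<=` proj_ideal)
}.

Lemma proj_prime (p : Proj) : is_prime p.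
Proof. by case: p. Qed.

End Proj.

Lemma hpartD (S : gradedRing) d (x y : S) :
  hpart d x -> hpart d y -> hpart d (x + y).
Proof.
move=> hx hy; rewrite -[y]opprK; apply: hpartB => //.
by rewrite -sub0r; apply: hpartB => //; exact: hpart0.
Qed.

(* The local ring of Proj S at p is the degree-zero part S_(p) of the
   localization of S at the homogeneous elements outside p. *)
Section Stalk.
Variables (S : gradedRing) (p : Proj S).

Record hfrac := HFrac {
  hnum : S;
  hden : S;
  hdeg : nat;
  hnumP : hpart hdeg hnum;
  hdenP : hpart hdeg hden;
  hdenNp : ~ proj_ideal p hden
}.

HB.instance Definition _ := gen_eqMixin hfrac.
HB.instance Definition _ := gen_choiceMixin hfrac.

Definition hfrac_eqv (f g : hfrac) : bool :=
  `[< exists t : S, [/\ is_homog t, ~ proj_ideal p t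
      & t * (hnum f * hden g - hnum g * hden f) = 0] >].

Lemma proj_mulN (x y : S) :
  ~ proj_ideal p x -> ~ proj_ideal p y -> ~ proj_ideal p (x * y).
Proof. by move=> px py; have [_ _ h] := proj_prime p; move=> /h[]. Qed.

Lemma is_homogM (x y : S) : is_homog x -> is_homog y -> is_homog (x * y).
Proof. by move=> [d dx] [e ey]; exists (d + e)%N; exact: hpartM. Qed.

Lemma proj_N1 : ~ proj_ideal p 1.
Proof. by have [_ ? _] := proj_prime p. Qed.

Lemma is_homog1 : is_homog (1 : S).
Proof. by exists 0%N; exact: hpart1. Qed.

Lemma hfrac_eqvW (f g : hfrac) :
  hnum f * hden g = hnum g * hden f -> hfrac_eqv f g.
Proof.
move=> e; apply/asboolP; exists 1; split; first exact: is_homog1.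
  exact: proj_N1.
by rewrite e subrr mulr0.
Qed.

Lemma hfrac_eqv_equiv : equiv_class_of hfrac_eqv.
Proof.
split=> [f|f g|g f h]; first exact: hfrac_eqvW.
  by apply/asboolP/asboolP => -[t [th pt e]]; exists t; split => //;
    rewrite -opprB mulrN e oppr0.
move=> /asboolP[t [th pt e1]] /asboolP[u [uh pu e2]]; apply/asboolP.
exists (t * u * hden g); split.
- by apply: is_homogM; [exact: is_homogM|exists (hdeg g); exact: hdenP].
- by apply: proj_mulN; [exact: proj_mulN|exact: hdenNp].
transitivity (u * hden h * (t * (hnum f * hden g - hnum g * hden f))
  + t * hden f * (u * (hnum g * hden h - hnum h * hden g))); first by ring.
by rewrite e1 e2 !mulr0 addr0.
Qed.

Canonical hfrac_equiv := EquivRelPack hfrac_eqv_equiv.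
Canonical hfrac_encModRel := defaultEncModRel hfrac_eqv.

Definition stalk := {eq_quot hfrac_eqv}.
HB.instance Definition _ : EqQuotient hfrac hfrac_eqv stalk :=
  EqQuotient.on stalk.
HB.instance Definition _ := Choice.on stalk.

Definition hfrac0 : hfrac := HFrac (hpart0 S 0) (hpart1 S) proj_N1.
Definition hfrac1 : hfrac := HFrac (hpart1 S) (hpart1 S) proj_N1.

Definition hfrac_opp (f : hfrac) : hfrac :=
  HFrac (hpartB (hpart0 S _) (hnumP f)) (hdenP f) (@hdenNp f).

Definition hfrac_add (f g : hfrac) : hfrac :=
  HFrac (hpartD (hpartM (hnumP f) (hdenP g)) (hpartM (hdenP f) (hnumP g)))
    (hpartM (hdenP f) (hdenP g)) (proj_mulN (@hdenNp f) (@hdenNp g)).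

Definition hfrac_mul (f g : hfrac) : hfrac :=
  HFrac (hpartM (hnumP f) (hnumP g)) (hpartM (hdenP f) (hdenP g))
    (proj_mulN (@hdenNp f) (@hdenNp g)).

Definition stalk0 : stalk := lift_cst stalk hfrac0.
Definition stalk1 : stalk := lift_cst stalk hfrac1.
Definition stalk_opp := lift_op1 stalk hfrac_opp.
Definition stalk_add := lift_op2 stalk hfrac_add.
Definition stalk_mul := lift_op2 stalk hfrac_mul.

Canonical pi_stalk0 := PiConst stalk0.
Canonical pi_stalk1 := PiConst stalk1.

Lemma stalk_reprP (f : hfrac) : exists t : S, [/\ is_homog t, ~ proj_ideal p t
  & t * (hnum f * hden (repr (\pi_stalk f))
         - hnum (repr (\pi_stalk f)) * hden f) = 0].
Proof.
have : f == repr (\pi_stalk f) %[mod stalk] by rewrite reprK.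
by rewrite eqmodE => /asboolP.
Qed.

Lemma pi_stalk_opp_subproof :
  {morph \pi_stalk : x / hfrac_opp x >-> stalk_opp x}.
Proof.
move=> f; unlock stalk_opp; apply/eqP; rewrite eqmodE; apply/asboolP.
have [t [th pt e]] := stalk_reprP f; exists t; split=> //=.
by rewrite !sub0r !mulNr -opprD mulrN e oppr0.
Qed.
Canonical pi_stalk_opp := PiMorph1 pi_stalk_opp_subproof.

Lemma pi_stalk_add_subproof :
  {morph \pi_stalk : x y / hfrac_add x y >-> stalk_add x y}.
Proof.
move=> f g; unlock stalk_add; apply/eqP; rewrite eqmodE; apply/asboolP.
have [t [th pt]] := stalk_reprP f; have [u [uh pu]] := stalk_reprP g.
set f' := repr (\pi_stalk f); set g' := repr (\pi_stalk g) => e2 e1.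
exists (t * u); split=> /=; [exact: is_homogM|exact: proj_mulN|].
transitivity (u * hden g * hden g' * (t * (hnum f * hden f' - hnum f' * hden f))
  + t * hden f * hden f' * (u * (hnum g * hden g' - hnum g' * hden g))).
  by ring.
by rewrite e1 e2 !mulr0 addr0.
Qed.
Canonical pi_stalk_add := PiMorph2 pi_stalk_add_subproof.

Lemma pi_stalk_mul_subproof :
  {morph \pi_stalk : x y / hfrac_mul x y >-> stalk_mul x y}.
Proof.
move=> f g; unlock stalk_mul; apply/eqP; rewrite eqmodE; apply/asboolP.
have [t [th pt]] := stalk_reprP f; have [u [uh pu]] := stalk_reprP g.
set f' := repr (\pi_stalk f); set g' := repr (\pi_stalk g) => e2 e1.
exists (t * u); split=> /=; [exact: is_homogM|exact: proj_mulN|].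
transitivity (u * hnum g * hden g' * (t * (hnum f * hden f' - hnum f' * hden f))
  + t * hnum f' * hden f * (u * (hnum g * hden g' - hnum g' * hden g))).
  by ring.
by rewrite e1 e2 !mulr0 addr0.
Qed.
Canonical pi_stalk_mul := PiMorph2 pi_stalk_mul_subproof.

Lemma hfrac_eqvP (f g : hfrac) :
  hnum f * hden g = hnum g * hden f -> \pi_stalk f = \pi_stalk g.
Proof. by move=> e; apply/eqP; rewrite eqmodE; exact: hfrac_eqvW. Qed.

Lemma stalk_addA : associative stalk_add.
Proof.
move=> x y z; rewrite -[x]reprK -[y]reprK -[z]reprK !piE.
by apply: hfrac_eqvP => /=; ring.
Qed.

Lemma stalk_addC : commutative stalk_add.
Proof.
move=> x y; rewrite -[x]reprK -[y]reprK !piE.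
by apply: hfrac_eqvP => /=; ring.
Qed.

Lemma stalk_add0 : left_id stalk0 stalk_add.
Proof. by move=> x; rewrite -[x]reprK !piE; apply: hfrac_eqvP => /=; ring. Qed.

Lemma stalk_addN : left_inverse stalk0 stalk_opp stalk_add.
Proof. by move=> x; rewrite -[x]reprK !piE; apply: hfrac_eqvP => /=; ring. Qed.

HB.instance Definition _ :=
  GRing.isZmodule.Build stalk stalk_addA stalk_addC stalk_add0 stalk_addN.

Lemma stalk_mulA : associative stalk_mul.
Proof.
move=> x y z; rewrite -[x]reprK -[y]reprK -[z]reprK !piE.
by apply: hfrac_eqvP => /=; ring.
Qed.

Lemma stalk_mulC : commutative stalk_mul.
Proof.
move=> x y; rewrite -[x]reprK -[y]reprK !piE.
by apply: hfrac_eqvP => /=; ring.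
Qed.

Lemma stalk_mul1 : left_id stalk1 stalk_mul.
Proof. by move=> x; rewrite -[x]reprK !piE; apply: hfrac_eqvP => /=; ring. Qed.

Lemma stalk_mulD : left_distributive stalk_mul stalk_add.
Proof.
move=> x y z; rewrite -[x]reprK -[y]reprK -[z]reprK !piE.
by apply: hfrac_eqvP => /=; ring.
Qed.

HB.instance Definition _ := GRing.Zmodule_isComPzRing.Build stalk
  stalk_mulA stalk_mulC stalk_mul1 stalk_mulD.

End Stalk.

(* A scheme is reduced when all its local rings are. *)
Definition Proj_is_reduced (S : gradedRing) : Prop :=
  forall p : Proj S, is_reduced (stalk p).

(* The ring \bigoplus_i m^i/m^(i+1) is built as a quotient of the Rees algebra
   \bigoplus_i m^i T^i, a subring of R[T], by its ideal
   \bigoplus_i m^(i+1) T^i. *)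
Section AssociatedGraded.
Variables (R : comNzRingType) (m : set R).

Definition rees_pred : {pred {poly R}} :=
  fun q => `[< forall i, ideal_exp m i q`_i >].

Lemma rees_subring : subring_closed rees_pred.
Proof.
split=> [|q r /asboolP hq /asboolP hr|q r /asboolP hq /asboolP hr];
  apply/asboolP => i.
- rewrite coef1; case: i => [|i] /=; first exact: ideal_exp0.
  by have [] := ideal_exp_ideal m i.+1.
- by rewrite coefB; exact: (ideal_sub (ideal_exp_ideal m _)).
- rewrite coefM; apply: (ideal_sum (ideal_exp_ideal m _)) => j _.
  rewrite -[X in ideal_exp m X](subnKC (ltn_ord j : (j <= i)%N)).
  exact: ideal_expD.
Qed.

HB.instance Definition _ :=
  GRing.isSubringClosed.Build {poly R} rees_pred rees_subring.

Record rees := Rees { rees_val :> {poly R}; _ : rees_val \in rees_pred }.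

HB.instance Definition _ := [isSub for rees_val].
HB.instance Definition _ := [Choice of rees by <:].
HB.instance Definition _ := [SubChoice_isSubComNzRing of rees by <:].

Lemma reesP (q : rees) i : ideal_exp m i q`_i.
Proof. by case: q => q /= /asboolP. Qed.

Definition rees_ideal : {pred rees} :=
  fun q => `[< forall i, ideal_exp m i.+1 q`_i >].

Lemma rees_ideal_zmod : zmod_closed rees_ideal.
Proof.
split=> [|q r /asboolP hq /asboolP hr]; apply/asboolP => i.
  by rewrite coef0; have [] := ideal_exp_ideal m i.+1.
by rewrite coefB; exact: (ideal_sub (ideal_exp_ideal m _)).
Qed.

Lemma rees_idealM (q r : rees) : r \in rees_ideal -> q * r \in rees_ideal.
Proof.
move=> /asboolP hr; apply/asboolP => i; rewrite coefM.
apply: (ideal_sum (ideal_exp_ideal m _)) => j _.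
rewrite -[X in ideal_exp m X.+1](subnKC (ltn_ord j : (j <= i)%N)) -addnS.
by apply: ideal_expD => //; exact: reesP.
Qed.

HB.instance Definition _ :=
  GRing.isZmodClosed.Build rees rees_ideal rees_ideal_zmod.

Definition gr := Quotient.quot rees_ideal.
HB.instance Definition _ := GRing.Zmodule.on gr.

Definition gr_one : gr := lift_cst gr 1.
Definition gr_mul := lift_op2 gr *%R.

Canonical pi_gr_one := PiConst gr_one.

Lemma pi_gr_mul_subproof : {morph \pi_gr : x y / x * y >-> gr_mul x y}.
Proof.
move=> x y; unlock gr_mul; apply/eqP; rewrite -Quotient.idealrBE.
rewrite -[_ * _](addrNK (x * repr (\pi_gr y))) -mulrBr.
rewrite -addrA -mulrBl rpredD //.
  by rewrite rees_idealM // Quotient.idealrBE reprK.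
by rewrite mulrC rees_idealM // Quotient.idealrBE reprK.
Qed.
Canonical pi_gr_mul := PiMorph2 pi_gr_mul_subproof.

Lemma gr_mulA : associative gr_mul.
Proof. by move=> x y z; rewrite -[x]reprK -[y]reprK -[z]reprK !piE mulrA. Qed.

Lemma gr_mulC : commutative gr_mul.
Proof. by move=> x y; rewrite -[x]reprK -[y]reprK !piE mulrC. Qed.

Lemma gr_mul1 : left_id gr_one gr_mul.
Proof. by move=> x; rewrite -[x]reprK !piE mul1r. Qed.

Lemma gr_mulD : left_distributive gr_mul +%R.
Proof.
by move=> x y z; rewrite -[x]reprK -[y]reprK -[z]reprK !piE mulrDl.
Qed.

HB.instance Definition _ :=
  GRing.Zmodule_isComPzRing.Build gr gr_mulA gr_mulC gr_mul1 gr_mulD.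

(* The image of m^d T^d, a copy of m^d/m^(d+1). *)
Definition gr_hpart (d : nat) : set gr :=
  [set \pi_gr q | q in [set q : rees | exists c, rees_val q = c *: 'X^d]].

Lemma pi_gr_zmod_morphism : zmod_morphism \pi_gr.
Proof. by move=> x y; rewrite !piE. Qed.

HB.instance Definition _ :=
  GRing.isZmodMorphism.Build rees gr \pi_gr pi_gr_zmod_morphism.

Lemma pi_gr_eq0 (q : rees) : (\pi_gr q == 0) = (q \in rees_ideal).
Proof. by rewrite -[q in RHS]subr0 Quotient.idealrBE raddf0. Qed.

Lemma gr_hpart0 d : gr_hpart d 0.
Proof. by exists 0; [exists 0; rewrite scale0r|rewrite raddf0]. Qed.

Lemma gr_hpartB d x y : gr_hpart d x -> gr_hpart d y -> gr_hpart d (x - y).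
Proof.
move=> [q [a qa] <-] [r [b rb] <-]; exists (q - r); last exact: raddfB.
by exists (a - b); rewrite scalerBl -qa -rb.
Qed.

Lemma gr_hpart1 : gr_hpart 0 1.
Proof.
by exists 1; [exists 1; rewrite expr0 scale1r|rewrite [RHS]piE].
Qed.

Lemma gr_hpartM d e x y :
  gr_hpart d x -> gr_hpart e y -> gr_hpart (d + e) (x * y).
Proof.
move=> [q [a qa] <-] [r [b rb] <-]; exists (q * r); last by rewrite !piE.
exists (a * b); rewrite [LHS](_ : _ = rees_val q * rees_val r) // qa rb.
by rewrite exprD -scalerAl -scalerAr scalerA.
Qed.

Lemma rees_homog_subproof (q : rees) i : q`_i *: 'X^i \in rees_pred.
Proof.
apply/asboolP => j; rewrite coefZ coefXn.
case: eqP => [->|_]; first by rewrite mulr1; exact: reesP.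
by rewrite mulr0; have [] := ideal_exp_ideal m j.
Qed.

Lemma gr_hpart_sum x : exists n (c : 'I_n -> gr),
  (forall i : 'I_n, gr_hpart i (c i)) /\ x = \sum_i c i.
Proof.
pose q := repr x.
exists (size q), (fun i => \pi_gr (Rees (rees_homog_subproof q i))); split.
  by move=> i; eexists; last reflexivity; exists q`_i.
rewrite -raddf_sum -[LHS]reprK; congr (\pi_gr _); apply: val_inj.
rewrite raddf_sum /= -/q -[LHS]coefK poly_def.
by apply: eq_bigr.
Qed.

Lemma gr_hpart_direct n (c : 'I_n -> gr) :
  (forall i : 'I_n, gr_hpart i (c i)) -> \sum_i c i = 0 -> forall i, c i = 0.
Proof.
move=> hc; pose q i := sval (cid2 (hc i)).
have qP i : exists a, rees_val (q i) = a *: 'X^i by rewrite /q; case: cid2.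
have qc i : \pi_gr (q i) = c i by rewrite /q; case: cid2.
under eq_bigr do rewrite -qc.
rewrite -raddf_sum => /eqP; rewrite pi_gr_eq0 => /asboolP h i.
apply/eqP; rewrite -qc pi_gr_eq0; apply/asboolP => j.
have [a qa] := qP i; rewrite qa coefZ coefXn.
case: eqP => [->|_]; last first.
  by rewrite mulr0; have [] := ideal_exp_ideal m j.+1.
move: (h i); rewrite [rees_val _](raddf_sum val) coef_sum.
rewrite (bigD1 i) //= qa coefZ coefXn eqxx.
rewrite big1 ?addr0 // => k ki; have [b ->] := qP k.
by rewrite coefZ coefXn eq_sym (inj_eq val_inj) (negPf ki) mulr0.
Qed.

Definition assoc_graded : gradedRing :=
  GradedRing gr_hpart0 gr_hpartB gr_hpart1 gr_hpartM gr_hpart_sum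
    gr_hpart_direct.

End AssociatedGraded.

Section X44.
Variable R : realType.
Local Notation C := R[i].

(* e^(it) *)
Definition cis (t : R) : C := (trigo.cos t +i* trigo.sin t)%C.

Definition omega : C := cis (trigo.pi / 12%:R).
Definition sigma : C := cis (2%:R * trigo.pi / 3%:R).

Definition mx2 (p q r s : C) : 'M[C]_2 :=
  \matrix_(i, j) (if i == 0 then if j == 0 then p else q
                  else if j == 0 then r else s).

Definition matA : 'M[C]_2 := mx2 'i 0 0 (- 'i).
Definition matB : 'M[C]_2 := mx2 0 1 (- 1) 0.
Definition matC : 'M[C]_2 := (omega / sqrtC 2%:R) *: mx2 1 (- 1) 'i 'i.
Definition matD : 'M[C]_2 := mx2 sigma 0 0 sigma.

Inductive G5 : 'M[C]_2 -> Prop :=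
| G5_a : G5 matA
| G5_b : G5 matB
| G5_c : G5 matC
| G5_d : G5 matD
| G5_1 : G5 1%:M
| G5_mul g h : G5 g -> G5 h -> G5 (g *m h)
| G5_inv g : G5 g -> G5 (invmx g).

(* Points of W = V + V^* are columns (x, y, X, Y), in this order. *)
Definition actW (g : 'M[C]_2) : 'M[C]_4 := block_mx g 0 0 (invmx g)^T.

Local Notation CW := {mpoly C[4]}.

Definition coord_x : CW := 'X_(inord 0).
Definition coord_y : CW := 'X_(inord 1).
Definition coord_X : CW := 'X_(inord 2).
Definition coord_Y : CW := 'X_(inord 3).

Definition act_poly (g : 'M[C]_2) (f : CW) : CW :=
  f \mPo [tuple \sum_j actW g i j *: 'X_j | i < 4].

Definition invariants : set CW :=
  [set f | forall g, G5 g -> act_poly g f = f].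

Definition nontrivial_stabiliser (w : 'cV[C]_4) : Prop :=
  exists g, [/\ G5 g, g <> 1%:M & actW g *m w = w].

(* The ideal of the image in W/G_5 of the points of W with non-trivial
   stabiliser: the invariants vanishing at all these points. *)
Definition sing_ideal : set CW :=
  [set f | invariants f
    /\ forall w, nontrivial_stabiliser w -> f.@[fun i => w i 0] = 0].

Definition G22 : CW :=
  coord_x ^+ 2 * coord_X ^+ 2
  + ('i * sqrtC 3%:R) *: (coord_x ^+ 2 * coord_Y ^+ 2)
  + ('i * sqrtC 3%:R) *: (coord_y ^+ 2 * coord_X ^+ 2)
  + coord_y ^+ 2 * coord_Y ^+ 2
  - 4%:R *: (coord_x * coord_y * coord_X * coord_Y).

Definition R44 : CW := G22 * map_mpoly Num.conj G22.

Local Notation K := {fraction CW}.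
Local Notation "f %:F" := (tofrac f).

Definition is_subring (A : set K) : Prop :=
  [/\ A 1, forall u v, A u -> A v -> A (u - v)
    & forall u v, A u -> A v -> A (u * v)].

(* Coordinate ring of the chart: C[W]^G_5 [r / R44 : r in sing_ideal]. *)
Definition X44_set : set K :=
  smallest is_subring
    ([set f%:F | f in invariants]
     `|` [set r%:F / R44%:F | r in sing_ideal]).

Definition X44_pred : {pred K} := fun u => `[< X44_set u >].

Lemma X44_subring : subring_closed X44_pred.
Proof.
split=> [|u v /asboolP hu /asboolP hv|u v /asboolP hu /asboolP hv];
  apply/asboolP => A AP; have [[h1 hB hM] _] := AP.
- exact: h1.
- by apply: hB; [apply: hu|apply: hv].
- by apply: hM; [apply: hu|apply: hv].
Qed.

HB.instance Definition _ := GRing.isSubringClosed.Build K X44_pred X44_subring.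

Record X44 := MkX44 { X44_val :> K; _ : X44_val \in X44_pred }.

HB.instance Definition _ := [isSub for X44_val].
HB.instance Definition _ := [Choice of X44 by <:].
HB.instance Definition _ := [SubChoice_isSubComNzRing of X44 by <:].

(* Homogeneous of positive total degree in the fraction field. *)
Definition pos_homog (u : K) : Prop :=
  exists (f g : CW) (d e : nat),
    [/\ f \is d.-homog, g \is e.-homog, g != 0, (e < d)%N & u = f%:F / g%:F].

(* The span of the homogeneous elements of positive degree; these are stable
   under multiplication by constants, so finite sums suffice. *)
Definition X44_origin : set X44 :=
  [set u | exists n (c : 'I_n -> X44),
    (forall i, pos_homog (c i)) /\ u = \sum_i c i].

End X44.

(* Main.v *)
Require Import Defs.
From HB Require Import structures.
From mathcomp Require Import all_boot all_order all_algebra.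
From mathcomp Require Import generic_quotient ring_quotient fraction.
From mathcomp Require Import boolp classical_sets reals complex mpoly ring.
From mathcomp Require trigo.
Set Implicit Arguments. Unset Strict Implicit. Unset Printing Implicit Defensive.
Import Order.TTheory GRing.Theory Num.Theory.
Local Open Scope classical_set_scope.
Local Open Scope ring_scope.
Local Open Scope quotient_scope.

(** Write m for the maximal ideal of the origin. The tangent cone is non-reduced
    because the sextic t = xy(x^4 - y^4) is an invariant lying in m but not in
    m^2, whose square lies in m^3: its class in m/m^2 is a nilpotent of the
    tangent cone. The work is in showing that this nilpotent is still non-zero
    at some point of Proj.

    The relation for t^2 is classical invariant theory. The quartics
    F = a(x^4 + y^4) + 6x^2y^2 with a = i sqrt 3, and G with - a instead, have
    polarisations F0 = F, F1, F2 and G0 = G, G1, G2 with respect to (- Y, X),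
    where F2 = G_{2,2} and G2 is its conjugate. With z = xX + yY, the fact that
    F and G are Hessians of one another reads F0 F2 = F1^2 - z^2 G0 and
    G0 G2 = G1^2 - z^2 F0, and F^3 + G^3 = - 108 t^2 ([quartic_hessian],
    [quartic_cubes]). Eliminating (with R = F2 G2 the polynomial R_{4,4}) gives
    - 108 t^2 as a sum of cubic monomials in z, F0 F1 F2 / R, G0 G1 G2 / R,
    F2^3 / R, G2^3 / R, F0^2 G0 G2 / R and G0^2 F0 F2 / R ([cubes_cubic]).
    All these are elements of m: the numerators are invariants divisible by F2
    or G2, and these vanish at the points with non-trivial stabiliser
    ([Phi2_stabiliser]).

    The point of Proj is the limit of an arc. Restriction to the arc
    s (eta, 1, eta, i), where eta = xi0 + s^2 and xi0^2 = - i, extends to a ring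
    morphism [chi] from the coordinate ring of the chart to polynomials in s,
    whose values on m are all divisible by s^4, while z has order exactly 4 and
    t only order 6. Such a morphism yields the prime ideal of those elements of
    the associated graded ring whose components in degree e have order more than
    4e, a point at which the nilpotent t/z does not vanish because 6 < 2 * 4
    ([Proj_gr_not_reduced]).

    The bound on the orders comes from the plane of the points (v, D v) with
    D = diag(1, i). On it F2 and G2 coincide, with four zeros, at which a
    reflection of order three has a fixed point. Elements of the ideal of the
    singular locus vanish there together with their gradient, hence are
    divisible by the restriction of R ([sing_ideal_on_plane]). Division by R
    takes degrees 8, 10, 12 to 0, 2, 4. Odd degrees do not occur, since - 1
    belongs to G_5. Invariants of degrees 2 and 10 vanish where the plane meets
    the quadric z = 0, that is, at xi0: there they coincide with binary forms
    invariant under the binary tetrahedral group, which has none in these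
    degrees ([on_plane_xi0]). As eta - xi0 = s^2, the contribution of degree 2
    after division has order 4 as well. *)

(** * Non-reducedness of a projective tangent cone *)

Section OrderCriterion.
Variables (A : comNzRingType) (m : set A) (F : fieldType).
Variables (chi : {rmorphism A -> {poly F}}) (N : nat).
Hypothesis chi_m : forall a, m a -> 'X^N %| chi a.

Lemma chi_ideal_exp n a : ideal_exp m n a -> 'X^(N * n) %| chi a.
Proof.
have iI : is_ideal [set b : A | 'X^(N * n) %| chi b].
  split=> [|b c hb hc|b c hc] /=; rewrite ?rmorph0 ?dvdp0 //.
    by rewrite rmorphD dvdp_add.
  by rewrite rmorphM dvdp_mull.
apply: (ideal_span_min iI) => _ [f mf <-] /=.
rewrite rmorph_prod exprM -[n in (_ ^+ n)]card_ord -prodr_const.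
apply: (big_ind2 (fun p q : {poly F} => p %| q)) => [//|p p1 q q1|i _]; first exact: dvdp_mul.
exact: chi_m.
Qed.

Lemma coef_lt_dvdXn n (p : {poly F}) i : 'X^n %| p -> (i < n)%N -> p`_i = 0.
Proof. by move=> /dvdpP[q ->] lt_in; rewrite coefMXn lt_in. Qed.

Lemma chi_rees_lt (q : rees m) i j : (j < N * i)%N -> (chi (rees_val q)`_i)`_j = 0.
Proof. by apply: coef_lt_dvdXn; apply: chi_ideal_exp; exact: reesP. Qed.

(** The coefficients of order exactly N * i, for the component of degree i:
    the map to the associated graded ring of the order filtration. *)
Definition lead_rees (q : rees m) : {poly F} :=
  \poly_(i < size (rees_val q)) (chi (rees_val q)`_i)`_(N * i).

Lemma coef_lead_rees q i : (lead_rees q)`_i = (chi (rees_val q)`_i)`_(N * i).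
Proof.
rewrite coef_poly; case: ltnP => // /(nth_default 0) ->.
by rewrite rmorph0 coef0.
Qed.

(** Both factors of degrees j and i - j have order at least N * j and
    N * (i - j), so only the product of their lowest terms contributes. *)
Lemma lead_reesM q r : lead_rees (q * r) = lead_rees q * lead_rees r.
Proof.
apply/polyP => i; rewrite coef_lead_rees !coefM rmorph_sum coef_sum /=.
apply: eq_bigr => j _; rewrite !coef_lead_rees rmorphM coefM.
have le_ji : (j <= i)%N by rewrite -ltnS.
have lt_j : (N * j < (N * i).+1)%N by rewrite ltnS leq_mul2l le_ji orbT.
rewrite (bigD1 (Ordinal lt_j)) //= big1 ?addr0 -?mulnBr // => l nlj.
have [lt|] := ltnP l (N * j); first by rewrite chi_rees_lt ?mul0r.
rewrite leq_eqVlt => /orP[/eqP e|lt]; first by case/eqP: nlj; apply: val_inj.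
rewrite [X in _ * X]chi_rees_lt ?mulr0 // mulnBr ltn_sub2l //.
by rewrite (leq_trans lt) // -ltnS.
Qed.

Lemma lead_reesB q r : lead_rees (q - r) = lead_rees q - lead_rees r.
Proof.
by apply/polyP => i; rewrite coefB !coef_lead_rees coefB rmorphB coefB.
Qed.

Hypothesis N_gt0 : (0 < N)%N.

Lemma lead_rees_ideal (q : rees m) : q \in @rees_ideal _ m -> lead_rees q = 0.
Proof.
move=> /asboolP hq; apply/polyP => i; rewrite coef_lead_rees coef0.
by apply: coef_lt_dvdXn (chi_ideal_exp (hq i)) _; rewrite ltn_mul2l N_gt0 ltnSn.
Qed.

Local Notation gr := (gr m).
Definition order_ideal : set gr := [set x | lead_rees (repr x) = 0].

Lemma order_idealE (q : rees m) : order_ideal (\pi_gr q) <-> lead_rees q = 0.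
Proof.
suff e : lead_rees (repr (\pi_gr q)) = lead_rees q by rewrite /order_ideal /= e.
apply/eqP; rewrite -subr_eq0 -lead_reesB; apply/eqP/lead_rees_ideal.
by rewrite Quotient.idealrBE reprK.
Qed.

Lemma lead_rees_mono (q : rees m) e c :
  rees_val q = c *: 'X^e -> lead_rees q = (chi c)`_(N * e) *: 'X^e.
Proof.
move=> qE; apply/polyP => i; rewrite coef_lead_rees qE !coefZ !coefXn.
by case: eqP => [->|_]; rewrite ?mulr1 // !mulr0 rmorph0 coef0.
Qed.

Lemma order_ideal_ideal : is_ideal order_ideal.
Proof.
have D : forall x y : gr, order_ideal x -> order_ideal y -> order_ideal (x - y).
  move=> x y; rewrite -[x]reprK -[y]reprK => /order_idealE hx /order_idealE hy.
  by rewrite -raddfB; apply/order_idealE; rewrite lead_reesB hx hy subrr.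
have I0 : order_ideal 0.
  rewrite -[0](raddf0 \pi_gr); apply/order_idealE.
  by rewrite -[0](subrr 0) lead_reesB subrr.
split=> // [x y hx hy|x y].
  by rewrite -[y]opprK; apply: (D) => //; rewrite -sub0r; apply: (D).
rewrite -[x]reprK -[y]reprK => /order_idealE hy; rewrite !piE.
by apply/order_idealE; rewrite lead_reesM hy mulr0.
Qed.

(** The kernel of [lead_rees] is prime since {poly F} is an integral domain. *)
Lemma order_ideal_prime : is_prime order_ideal.
Proof.
split; first exact: order_ideal_ideal.
  rewrite [1]piE => /order_idealE /polyP/(_ 0%N).
  by rewrite coef_lead_rees muln0 coef1 /= rmorph1 coef1 coef0 => /eqP; rewrite oner_eq0.
move=> x y; rewrite -[x]reprK -[y]reprK !piE => /order_idealE.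
rewrite lead_reesM => /eqP; rewrite mulf_eq0 => /orP[] /eqP h; [left|right];
  exact/order_idealE.
Qed.

Lemma order_ideal_homog :
  @is_homog_ideal (assoc_graded m) order_ideal.
Proof.
split; first exact: order_ideal_ideal.
apply/seteqP; split=> [x|]; last first.
  by apply: ideal_span_min; [exact: order_ideal_ideal|move=> x []].
rewrite -[x]reprK => /order_idealE; set q := repr x => hq.
pose c i := Rees (rees_homog_subproof q i).
have -> : \pi_gr q = \sum_(i < size (rees_val q)) \pi_gr (c i).
  rewrite -raddf_sum; congr (\pi_gr _); apply: val_inj.
  by rewrite raddf_sum /= -[LHS]coefK poly_def; apply: eq_bigr.
apply: (ideal_sum (ideal_span_ideal _)) => i _; apply: ideal_span_sub; split.
  apply/order_idealE; rewrite (lead_rees_mono (erefl _ : rees_val (c i) = _)).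
  by rewrite -coef_lead_rees hq coef0 scale0r.
by exists i; exists (c i) => //; exists (rees_val q)`_i.
Qed.

Lemma ideal_exp1 a : m a -> ideal_exp m 1 a.
Proof.
by move=> ma; apply: ideal_span_sub; exists (fun=> a); rewrite // big_ord1.
Qed.

Lemma rees_degree1_subproof a : m a -> a *: 'X \in rees_pred m.
Proof.
move=> ma; apply/asboolP => i; rewrite coefZ coefX.
have [I0 _ _] := ideal_exp_ideal m i.
by case: eqP => [->|_]; rewrite ?mulr0 // mulr1; exact: ideal_exp1.
Qed.

Definition rees1 a (ma : m a) : rees m := Rees (rees_degree1_subproof ma).

Lemma hpart_rees1 a (ma : m a) : @hpart (assoc_graded m) 1 (\pi_gr (rees1 ma)).
Proof. by exists (rees1 ma) => //; exists a. Qed.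

Variable z : A.
Hypotheses (mz : m z) (chi_z : (chi z)`_N != 0).

Lemma order_ideal_rees1 : ~ order_ideal (\pi_gr (rees1 mz)).
Proof.
move=> /order_idealE /polyP/(_ 1%N); rewrite coef_lead_rees muln1 coef0 /=.
by rewrite coefZ coefX mulr1; apply/eqP.
Qed.

(** The class of z has positive degree and is not in the ideal. *)
Lemma order_ideal_relevant :
  ~ (@irrelevant_ideal (assoc_graded m) `<=` order_ideal).
Proof.
move=> /(_ (\pi_gr (rees1 mz))) h; apply: order_ideal_rees1; apply: h.
by apply: ideal_span_sub; exists 1%N => //; exact: hpart_rees1.
Qed.

Definition order_point : Proj (assoc_graded m) :=
  @ProjPoint (assoc_graded m) _ order_ideal_prime order_ideal_homog order_ideal_relevant.

Variable t : A.
Hypotheses (mt : m t) (t2 : ideal_exp m 3 (t ^+ 2)).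
Hypothesis chi_t : ~~ ('X^(2 * N) %| chi t).

(** At [order_point], t / z squares to zero because t^2 vanishes in degree 2 of
    the associated graded ring. Were t / z zero, c t would lie in m^(e+2) for
    some c in m^e of order exactly N e; then t would have order at least 2 N. *)
Lemma Proj_gr_not_reduced : ~ Proj_is_reduced (assoc_graded m).
Proof.
move=> /(_ order_point) red.
pose zz : gr := \pi_gr (rees1 mz); pose tt : gr := \pi_gr (rees1 mt).
have zzP : ~ proj_ideal order_point zz by exact: order_ideal_rees1.
have tt2 : tt * tt = 0.
  rewrite [LHS]piE; apply/eqP; rewrite pi_gr_eq0; apply/asboolP => i.
  rewrite [rees_val _](_ : _ = (t ^+ 2) *: 'X^2); last first.
    by rewrite [LHS](_ : _ = (t *: 'X) * (t *: 'X)) // -scalerAl -scalerAr scalerA.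
  rewrite coefZ coefXn; have [I0 _ _] := ideal_exp_ideal m i.+1.
  by case: eqP => [->|_]; rewrite ?mulr0 // mulr1.
pose f : hfrac order_point := HFrac (hpart_rees1 mt) (hpart_rees1 mz) zzP.
have /red : (\pi_(stalk order_point) f) ^+ 2 = 0.
  by rewrite expr2 !piE; apply: hfrac_eqvP; rewrite /= -/tt tt2 !mul0r.
rewrite [X in _ = X -> _]piE => /eqP; rewrite eqmodE => /asboolP[T [[e [q [c qE] <-]]]].
rewrite /= mulr1 mul0r subr0 => /order_idealE NT.
rewrite [X in X = _ -> _]piE => /eqP; rewrite pi_gr_eq0 => /asboolP/(_ e.+1).
rewrite [rees_val _](_ : _ = (c * t) *: 'X^(e.+1)); last first.
  by rewrite [LHS](_ : _ = rees_val q * (t *: 'X)) // qE -scalerAl -scalerAr scalerA -exprSr.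
rewrite coefZ coefXn eqxx mulr1 => /chi_ideal_exp; rewrite rmorphM.
have cN : (chi c)`_(N * e) != 0.
  apply/eqP => h; apply: NT; rewrite (lead_rees_mono qE) h scale0r //.
have : 'X^(N * e) %| chi c.
  by apply: chi_ideal_exp; have := @reesP _ _ q e; rewrite qE coefZ coefXn eqxx mulr1.
move=> /dvdpP[g chic].
have g0 : ~~ root g 0.
  by move: cN; rewrite chic coefMXn ltnn subnn rootE horner_coef0.
rewrite chic -mulrA mulrCA.
have -> : (N * e.+2 = N * e + 2 * N)%N by ring.
rewrite exprD dvdp_mul2l ?expf_neq0 ?polyX_eq0 //.
rewrite Gauss_dvdpr ?(negPf chi_t) //.
by rewrite coprimep_expl // coprimep_sym -['X]subr0 -polyC0 coprimep_XsubC.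
Qed.

End OrderCriterion.

(** * Restriction of polynomials to curves, and homogeneous components *)

Section MpolyCurves.

Lemma rmorph_mmap n (R : nzRingType) (S T : comNzRingType) (h : {rmorphism S -> T})
    (f : {rmorphism R -> S}) (phi : 'I_n -> S) (p : {mpoly R[n]}) :
  h (mmap f phi p) = mmap (h \o f) (h \o phi) p.
Proof.
rewrite /mmap rmorph_sum; apply: eq_bigr => m _; rewrite rmorphM /mmap1 /=.
by congr (_ * _); rewrite rmorph_prod; apply: eq_bigr => i _; rewrite rmorphXn.
Qed.

Lemma eq_mmap n (R S : nzRingType) (f g : R -> S) (phi psi : 'I_n -> S)
    (p : {mpoly R[n]}) : f =1 g -> phi =1 psi -> mmap f phi p = mmap g psi p.
Proof.
move=> fg pp; rewrite /mmap; apply: eq_bigr => m _; rewrite fg; congr (_ * _).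
by apply: eq_bigr => i _; rewrite pp.
Qed.

Lemma mmap_scale n (R : nzRingType) (S : comNzRingType) (h : R -> S)
    (phi : 'I_n -> S) (t : S) d (p : {mpoly R[n]}) : p \is d.-homog ->
  mmap h (fun i => t * phi i) p = t ^+ d * mmap h phi p.
Proof.
move=> /dhomogP hf; rewrite /mmap big_distrr /=; apply: eq_big_seq => m /hf /= md.
rewrite mulrCA; congr (_ * _); rewrite /mmap1.
rewrite (eq_bigr (fun i => t ^+ m i * phi i ^+ m i)); last by move=> i _; rewrite exprMn.
by rewrite big_split /= prodrXr -mdegE md.
Qed.

Variables (n : nat) (C : comNzRingType).
Implicit Types (phi : 'I_n -> {poly C}) (f : {mpoly C[n]}) (t : {poly C}).

Definition pull phi f : {poly C} := mmap (@polyC C) phi f.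

HB.instance Definition _ phi :=
  GRing.RMorphism.copy (pull phi) (mmap (@polyC C) phi).

Lemma pullM phi f g : pull phi (f * g) = pull phi f * pull phi g.
Proof. exact: rmorphM. Qed.

Lemma pullC phi c : pull phi c%:MP = c%:P.
Proof. exact: mmapC. Qed.

Lemma pullZ phi c f : pull phi (c *: f) = c *: pull phi f.
Proof. by rewrite /pull mmapZ mul_polyC. Qed.

Lemma pullX phi i : pull phi 'X_i = phi i.
Proof. by rewrite /pull mmapX mmap1U. Qed.

Lemma horner_pull phi f a : (pull phi f).[a] = f.@[fun i => (phi i).[a]].
Proof.
rewrite -[_.[a]]/(horner_eval a _) rmorph_mmap; apply: eq_mmap => // c /=.
exact: hornerC.
Qed.

Lemma comp_pull phi f t : pull phi f \Po t = pull (fun i => phi i \Po t) f.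
Proof.
rewrite -[_ \Po t]/(comp_poly t _) rmorph_mmap; apply: eq_mmap => // c /=.
exact: comp_polyC.
Qed.

Lemma pull_comp_mpoly phi f (s : n.-tuple {mpoly C[n]}) :
  pull phi (f \mPo s) = pull (fun i => pull phi (tnth s i)) f.
Proof.
rewrite [LHS]rmorph_mmap; apply: eq_mmap => // c /=; exact: pullC.
Qed.

Lemma eq_pull phi psi f : phi =1 psi -> pull phi f = pull psi f.
Proof. exact: eq_mmap. Qed.

Lemma pull_scale d phi f t : f \is d.-homog ->
  pull (fun i => t * phi i) f = t ^+ d * pull phi f.
Proof. exact: mmap_scale. Qed.

Lemma pull_pihomog phi f :
  pull phi f = \sum_(d < msize f) pull phi (pihomog mdeg d f).
Proof. by rewrite {1}(@pihomog_partitionE _ _ mdeg (msize f) f) // rmorph_sum. Qed.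

(** The chain rule. The polynomials f that satisfy it form a ring which
    contains the constants and the variables. *)
Lemma deriv_pull phi f :
  (pull phi f)^`() = \sum_i pull phi f^`M(i) * (phi i)^`().
Proof.
pose P f := (pull phi f)^`() = \sum_i pull phi f^`M(i) * (phi i)^`().
have PM g h : P g -> P h -> P (g * h).
  rewrite /P rmorphM derivM => -> ->.
  rewrite mulr_suml mulr_sumr -big_split /=; apply: eq_bigr => i _.
  by rewrite mderivM rmorphD !rmorphM /=; ring.
have PC c : P c%:MP.
  by rewrite /P pullC derivC big1 // => i _; rewrite mderivC rmorph0 mul0r.
have PX i : P 'X_i.
  rewrite /P pullX (bigD1 i) //= big1 ?addr0.
    by rewrite mderivX mnm1E eqxx scale1r (_ : U_(i) - U_(i) = 0)%MM ?mpolyX0 ?rmorph1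
      ?mul1r //; last by apply/mnmP => j; rewrite !mnmE subnn.
  by move=> j /negPf ji; rewrite mderivX mnm1E eq_sym ji scale0r rmorph0 mul0r.
rewrite -/(P f) [f]mpolyE; elim/big_ind: _.
- exact: PC 0.
- move=> g h Pg Ph; rewrite /P rmorphD derivD Pg Ph -big_split /=.
  by apply: eq_bigr => i _; rewrite mderivD rmorphD mulrDl.
move=> m _; rewrite -mul_mpolyC; apply: (PM) => //; rewrite mpolyXE_id.
elim/big_ind: _; [exact: PC 1|exact: (PM)|move=> i _].
by elim: (m i) => [|k IH]; [exact: PC 1|rewrite exprS; apply: (PM)].
Qed.

End MpolyCurves.

Lemma size_pull n (C : idomainType) d (phi : 'I_n -> {poly C}) (f : {mpoly C[n]}) :
  f \is d.-homog -> (forall i, size (phi i) <= 2)%N -> (size (pull phi f) <= d.+1)%N.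
Proof.
move=> /dhomogP hf hphi; rewrite /pull /mmap.
rewrite big_seq; elim/big_ind: _ => [|p q hp hq|m /hf /= md]; first by rewrite size_poly0.
  by rewrite (leq_trans (size_polyD _ _)) // geq_max hp.
rewrite mul_polyC (leq_trans (size_scale_leq _ _)) // -md mdegE /mmap1.
elim/big_ind2: _ => [|k p l q hp hq|i _]; first by rewrite size_poly1.
  rewrite (leq_trans (size_polyMleq _ _)) //.
  by case: (_ + _)%N (leq_add hp hq) => //= s; rewrite addSn addnS ltnS.
have [->|nz] := eqVneq (phi i ^+ m i) 0; first by rewrite size_poly0.
rewrite (leq_trans (size_poly_exp_leq _ _)) // ltnS -[leqRHS]mul1n leq_mul2r.
by case: (size _) (hphi i) => [|[|[]]] //= _; rewrite orbT.
Qed.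

Lemma dhomog_comp n (K : comNzRingType) (s : n.-tuple {mpoly K[n]}) d (p : {mpoly K[n]}) :
  (forall i, tnth s i \is 1.-homog) -> p \is d.-homog -> p \mPo s \is d.-homog.
Proof.
move=> hs /dhomogP hp; rewrite comp_mpolyEX big_seq; apply: rpred_sum => m /hp /= md.
apply: rpredZ; rewrite comp_mpolyX -md mdegE.
elim/big_ind2: _ => [|p1 d1 p2 d2|i _]; [exact: dhomog1|exact: dhomogM|].
by have := dhomogMn (m i) (hs i); rewrite mul1n.
Qed.

Lemma pihomog_partition_leq n (K : nzRingType) (f : {mpoly K[n]}) k :
  (msize f <= k)%N -> f = \sum_(d < k) pihomog mdeg d f.
Proof. exact: pihomog_partitionE. Qed.

(** Multiplication by a form of degree e shifts the degrees by e. *)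
Lemma pihomogM n (K : comNzRingType) (f g : {mpoly K[n]}) e j : g \is e.-homog ->
  pihomog mdeg (j + e) (f * g) = pihomog mdeg j f * g.
Proof.
move=> hg; pose k := maxn (msize f) j.+1; have jk : (j < k)%N by rewrite leq_maxr.
have fE := pihomog_partition_leq (leq_maxl _ j.+1 : (msize f <= k)%N).
rewrite {1}fE mulr_suml [LHS](raddf_sum (pihomog mdeg (j + e))) [LHS](bigD1 (Ordinal jk)) //=.
rewrite [X in _ + X]big1 ?addr0.
  by apply: pihomog_dE; apply: dhomogM => //; exact: pihomogP.
move=> l lj; apply: (@pihomog_ne0 _ _ _ (l + e)%N); last first.
  by apply: dhomogM => //; exact: pihomogP.
by rewrite eqn_add2r; apply: contraNneq lj => lj; apply/eqP/val_inj.
Qed.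

(** * The tetrahedral quartics and the sextic *)

Section Quartic.
Variable S : comNzRingType.
Implicit Types a k h j x y X Y : S.

(** The tetrahedral quartic and, up to the numerical factors 4 and 12, its first
    two polarisations with respect to the vector (- Y, X), which transforms like
    (x, y) under SL_2. *)
Definition quartic0 a x y : S := a * (x ^+ 4 + y ^+ 4) + 6%:R * (x ^+ 2 * y ^+ 2).
Definition quartic1 a x y X Y : S := a * (y ^+ 3 * X - x ^+ 3 * Y)
  + 3%:R * (x ^+ 2 * y * X - x * y ^+ 2 * Y).
Definition quartic2 a x y X Y : S := a * (x ^+ 2 * Y ^+ 2 + y ^+ 2 * X ^+ 2)
  + (x ^+ 2 * X ^+ 2 + y ^+ 2 * Y ^+ 2 - 4%:R * (x * y * X * Y)).

(** The product of the six linear forms vanishing at the vertices of the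
    octahedron. *)
Definition sextic x y : S := x * y * (x ^+ 4 - y ^+ 4).

Variables (a x y X Y : S).
Hypothesis a2 : a ^+ 2 = - 3%:R.

(** For a binary quartic F and its polarisations, F0 F2 - F1^2 is, up to a
    constant, the Hessian of F times the square of the determinant of (x, y) and
    (- Y, X); and the Hessian of the quartic is the conjugate quartic. *)
Lemma quartic_hessian : quartic0 a x y * quartic2 a x y X Y =
  quartic1 a x y X Y ^+ 2 - (x * X + y * Y) ^+ 2 * quartic0 (- a) x y.
Proof. by rewrite /quartic0 /quartic1 /quartic2; ring : a2. Qed.

Lemma quartic_cubes : quartic0 a x y ^+ 3 + quartic0 (- a) x y ^+ 3 =
  - 108%:R * sextic x y ^+ 2.
Proof. by rewrite /quartic0 /sextic; ring : a2. Qed.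

Variables (k h j : S).
Hypothesis j2 : j ^+ 2 = -1.

(** The substitution is the action of the reflection c, with k = kappa,
    h = 1 / (2 kappa) and j = i. *)
Lemma quartic0_reflection : quartic0 a (k * (x - y)) (k * j * (x + y)) =
  2%:R * k ^+ 4 * (1 + a) * quartic0 a x y.
Proof. by rewrite /quartic0; ring : a2 j2. Qed.

Lemma quartic1_reflection :
  quartic1 a (k * (x - y)) (k * j * (x + y)) (h * (X - Y)) (- j * h * (X + Y)) =
  - (2%:R * j * k ^+ 3 * h * (1 + a)) * quartic1 a x y X Y.
Proof. by rewrite /quartic1; ring : a2 j2. Qed.

Lemma quartic2_reflection :
  quartic2 a (k * (x - y)) (k * j * (x + y)) (h * (X - Y)) (- j * h * (X + Y)) =
  - (2%:R * k ^+ 2 * h ^+ 2 * (1 + a)) * quartic2 a x y X Y.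
Proof. by rewrite /quartic2; ring : a2 j2. Qed.

Lemma sextic_reflection : 8%:R * j * k ^+ 6 = -1 ->
  sextic (k * (x - y)) (k * j * (x + y)) = sextic x y.
Proof.
move=> k6; transitivity (- (8%:R * j * k ^+ 6) * sextic x y).
  by rewrite /sextic; ring : j2.
by rewrite k6 opprK mul1r.
Qed.

Lemma sextic_diag : sextic (j * x) (- j * y) = sextic x y.
Proof. by rewrite /sextic; ring : j2. Qed.

Lemma sextic_swap : sextic y (- x) = sextic x y.
Proof. by rewrite /sextic; ring. Qed.

Variables (s : S).
Hypothesis s3 : s ^+ 3 = 1.

Lemma sextic_scalar : sextic (s * x) (s * y) = sextic x y.
Proof. by rewrite /sextic; ring : s3. Qed.

(** As p ^+ 12 = 1, the factors on the dual coordinates X and Y are the inverses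
    of p and p ^+ 7. *)
Lemma quartic2_monomial p : p ^+ 12 = 1 ->
  quartic2 a (p * x) (p ^+ 7 * y) (p ^+ 11 * X) (p ^+ 5 * Y) = quartic2 a x y X Y /\
  quartic2 a (p * y) (- p ^+ 7 * x) (p ^+ 11 * Y) (- p ^+ 5 * X) = quartic2 a x y X Y.
Proof. by move=> p12; split; rewrite /quartic2; ring : p12. Qed.

Lemma quartic_diag : [/\ quartic0 a (j * x) (- j * y) = quartic0 a x y,
  quartic1 a (j * x) (- j * y) (- j * X) (j * Y) = quartic1 a x y X Y &
  quartic2 a (j * x) (- j * y) (- j * X) (j * Y) = quartic2 a x y X Y].
Proof. by split; rewrite /quartic0 /quartic1 /quartic2; ring : j2. Qed.

Lemma quartic_swap : [/\ quartic0 a y (- x) = quartic0 a x y,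
  quartic1 a y (- x) Y (- X) = quartic1 a x y X Y &
  quartic2 a y (- x) Y (- X) = quartic2 a x y X Y].
Proof. by split; rewrite /quartic0 /quartic1 /quartic2; ring. Qed.

Lemma quartic_scalar : [/\ quartic0 a (s * x) (s * y) = s * quartic0 a x y,
  quartic1 a (s * x) (s * y) (s ^+ 2 * X) (s ^+ 2 * Y) = s ^+ 2 * quartic1 a x y X Y &
  quartic2 a (s * x) (s * y) (s ^+ 2 * X) (s ^+ 2 * Y) = quartic2 a x y X Y].
Proof. by split; rewrite /quartic0 /quartic1 /quartic2; ring : s3. Qed.

End Quartic.

Section QuarticMorphism.
Variables (S T : comNzRingType) (f : {rmorphism S -> T}).

Lemma rmorph_quartic0 a x y : f (quartic0 a x y) = quartic0 (f a) (f x) (f y).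
Proof.
rewrite /quartic0 rmorphD (rmorphM _ a) (rmorphM _ 6%:R) (rmorphM _ (x ^+ 2)).
by rewrite rmorphD !rmorphXn rmorph_nat.
Qed.

Lemma rmorph_sextic x y : f (sextic x y) = sextic (f x) (f y).
Proof. by rewrite /sextic (rmorphM _ (x * y)) (rmorphM _ x) rmorphB !rmorphXn. Qed.

Lemma rmorph_quartic1 a x y X Y :
  f (quartic1 a x y X Y) = quartic1 (f a) (f x) (f y) (f X) (f Y).
Proof.
rewrite /quartic1 rmorphD (rmorphM _ a) (rmorphM _ 3%:R) !rmorphB.
rewrite (rmorphM _ (y ^+ 3)) (rmorphM _ (x ^+ 3)) (rmorphM _ (x ^+ 2 * y)).
rewrite (rmorphM _ (x ^+ 2)) (rmorphM _ (x * y ^+ 2)) (rmorphM _ x).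
by rewrite !rmorphXn rmorph_nat.
Qed.

Lemma rmorph_quartic2 a x y X Y :
  f (quartic2 a x y X Y) = quartic2 (f a) (f x) (f y) (f X) (f Y).
Proof.
rewrite /quartic2 rmorphD (rmorphM _ a) rmorphD rmorphB rmorphD (rmorphM _ 4%:R).
rewrite !(rmorphM _ (x ^+ 2)) !(rmorphM _ (y ^+ 2)) (rmorphM _ (x * y * X)).
by rewrite (rmorphM _ (x * y)) (rmorphM _ x) !rmorphXn rmorph_nat.
Qed.

Lemma rmorph_mult0 k a :
  f (2%:R * k ^+ 4 * (1 + a)) = 2%:R * f k ^+ 4 * (1 + f a).
Proof.
rewrite (rmorphM _ (2%:R * k ^+ 4)) (rmorphM _ 2%:R) rmorph_nat rmorphXn rmorphD.
by rewrite rmorph1.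
Qed.

Lemma rmorph_mult1 j k h a : f (- (2%:R * j * k ^+ 3 * h * (1 + a))) =
  - (2%:R * f j * f k ^+ 3 * f h * (1 + f a)).
Proof.
rewrite rmorphN (rmorphM _ (2%:R * j * k ^+ 3 * h)) (rmorphM _ (2%:R * j * k ^+ 3)).
by rewrite (rmorphM _ (2%:R * j)) (rmorphM _ 2%:R) rmorph_nat rmorphXn rmorphD rmorph1.
Qed.

Lemma rmorph_mult2 k h a : f (- (2%:R * k ^+ 2 * h ^+ 2 * (1 + a))) =
  - (2%:R * f k ^+ 2 * f h ^+ 2 * (1 + f a)).
Proof.
rewrite rmorphN (rmorphM _ (2%:R * k ^+ 2 * h ^+ 2)) (rmorphM _ (2%:R * k ^+ 2)).
by rewrite (rmorphM _ 2%:R) rmorph_nat !rmorphXn rmorphD rmorph1.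
Qed.

End QuarticMorphism.

Section QuarticComp.
Variables (n : nat) (K : comNzRingType) (T : n.-tuple {mpoly K[n]}).
Implicit Types (a : K) (x y X Y : {mpoly K[n]}).

Lemma comp_quartic0 a x y :
  quartic0 a%:MP x y \mPo T = quartic0 a%:MP (x \mPo T) (y \mPo T).
Proof. by rewrite (rmorph_quartic0 (comp_mpoly T)) /= comp_mpolyC. Qed.

Lemma comp_quartic1 a x y X Y : quartic1 a%:MP x y X Y \mPo T =
  quartic1 a%:MP (x \mPo T) (y \mPo T) (X \mPo T) (Y \mPo T).
Proof. by rewrite (rmorph_quartic1 (comp_mpoly T)) /= comp_mpolyC. Qed.

Lemma comp_quartic2 a x y X Y : quartic2 a%:MP x y X Y \mPo T =
  quartic2 a%:MP (x \mPo T) (y \mPo T) (X \mPo T) (Y \mPo T).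
Proof. by rewrite (rmorph_quartic2 (comp_mpoly T)) /= comp_mpolyC. Qed.

Lemma comp_sextic x y : sextic x y \mPo T = sextic (x \mPo T) (y \mPo T).
Proof. exact: (rmorph_sextic (comp_mpoly T)). Qed.

Lemma pull_sextic (phi : 'I_n -> {poly K}) x y :
  pull phi (sextic x y) = sextic (pull phi x) (pull phi y).
Proof. exact: (rmorph_sextic (pull phi)). Qed.

Lemma meval_quartic2 (v : 'I_n -> K) a x y X Y : (quartic2 a%:MP x y X Y).@[v] =
  quartic2 a x.@[v] y.@[v] X.@[v] Y.@[v].
Proof. by rewrite (rmorph_quartic2 (meval v)) /= mevalC. Qed.

End QuarticComp.

Lemma map_quartic2 n (K L : comNzRingType) (f : {rmorphism K -> L}) a
    (x y X Y : {mpoly K[n]}) : map_mpoly f (quartic2 a%:MP x y X Y) =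
  quartic2 (f a)%:MP (map_mpoly f x) (map_mpoly f y) (map_mpoly f X) (map_mpoly f Y).
Proof. by rewrite (rmorph_quartic2 (map_mpoly f)) /= map_mpolyC. Qed.

Section SumOfCubes.
Variables (K : fieldType) (f0 f1 f2 g0 g1 g2 z : K).
Hypotheses (f2_neq0 : f2 != 0) (g2_neq0 : g2 != 0).
Hypotheses (hf : f0 * f2 = f1 ^+ 2 - z ^+ 2 * g0) (hg : g0 * g2 = g1 ^+ 2 - z ^+ 2 * f0).

(** f0^3 = f0^2 f1^2 / f2 - z^2 f0^2 g0 / f2 by the first relation, and
    likewise for g0^3. Each term is then rewritten with the denominator f2 g2,
    as a product of three fractions or of z^2 and one. *)
Lemma cubes_cubic : f0 ^+ 3 + g0 ^+ 3 =
  (f2 * (f0 * f1) / (f2 * g2)) ^+ 2 * (g2 * (g2 * g2) / (f2 * g2))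
  + (g2 * (g0 * g1) / (f2 * g2)) ^+ 2 * (f2 * (f2 * f2) / (f2 * g2))
  - z ^+ 2 * (g2 * (f0 * (f0 * g0)) / (f2 * g2) + f2 * (g0 * (g0 * f0)) / (f2 * g2)).
Proof.
have hf1 : f1 ^+ 2 = f0 * f2 + z ^+ 2 * g0 by rewrite hf subrK.
have hg1 : g1 ^+ 2 = g0 * g2 + z ^+ 2 * f0 by rewrite hg subrK.
by field : hf1 hg1; rewrite f2_neq0 g2_neq0.
Qed.

End SumOfCubes.

Local Notation "f %:F" := (tofrac f).

Lemma frac_sqr_cubic (D : idomainType) (f0 f1 f2 g0 g1 g2 z t k r : D) :
  r = f2 * g2 -> r%:F != 0 -> f0 * f2 = f1 ^+ 2 - z ^+ 2 * g0 ->
  g0 * g2 = g1 ^+ 2 - z ^+ 2 * f0 -> f0 ^+ 3 + g0 ^+ 3 = - 108%:R * t ^+ 2 ->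
  - 108%:R * k = 1 ->
  let u := (f2 * (f0 * f1))%:F / r%:F in let v := (g2 * (g0 * g1))%:F / r%:F in
  t%:F * t%:F = k%:F * (u * u * ((g2 * (g2 * g2))%:F / r%:F)
    + v * v * ((f2 * (f2 * f2))%:F / r%:F)
    - (z%:F * z%:F * ((g2 * (f0 * (f0 * g0)))%:F / r%:F)
      + z%:F * z%:F * ((f2 * (g0 * (g0 * f0)))%:F / r%:F))).
Proof.
move=> rE r0 hf hg ht hk u v.
have [f20 g20] : f2%:F != 0 /\ g2%:F != 0.
  by apply/andP; rewrite -negb_or -mulf_eq0 -tofracM -rE.
have hf' : f0%:F * f2%:F = f1%:F ^+ 2 - z%:F ^+ 2 * g0%:F.
  by rewrite -tofracM hf tofracB tofracM !tofracXn.
have hg' : g0%:F * g2%:F = g1%:F ^+ 2 - z%:F ^+ 2 * f0%:F.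
  by rewrite -tofracM hg tofracB tofracM !tofracXn.
have -> : t%:F * t%:F = k%:F * (f0%:F ^+ 3 + g0%:F ^+ 3).
  rewrite -!tofracXn -tofracD ht -!tofracM; congr (_%:F).
  by rewrite mulrA [k * _]mulrC hk mul1r expr2.
rewrite (cubes_cubic f20 g20 hf' hg') /u /v rE !tofracM; congr (_ * _).
ring.
Qed.

Section HomogeneousQuartic.
Variables (n : nat) (K : comNzRingType).
Variables (x y X Y : {mpoly K[n]}) (a : K).
Hypotheses (hx : x \is 1.-homog) (hy : y \is 1.-homog).
Hypotheses (hX : X \is 1.-homog) (hY : Y \is 1.-homog).

Lemma dhomog_nat d k (p : {mpoly K[n]}) : p \is d.-homog -> k%:R * p \is d.-homog.
Proof. by move=> hp; rewrite mulr_natl rpredMn. Qed.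

Lemma dhomog_C d (c : K) (p : {mpoly K[n]}) : p \is d.-homog -> c%:MP * p \is d.-homog.
Proof. by move=> hp; rewrite mul_mpolyC rpredZ. Qed.

Let x2 : x ^+ 2 \is 2.-homog := dhomogMn 2 hx.
Let y2 : y ^+ 2 \is 2.-homog := dhomogMn 2 hy.
Let X2 : X ^+ 2 \is 2.-homog := dhomogMn 2 hX.
Let Y2 : Y ^+ 2 \is 2.-homog := dhomogMn 2 hY.
Let x3 : x ^+ 3 \is 3.-homog := dhomogMn 3 hx.
Let y3 : y ^+ 3 \is 3.-homog := dhomogMn 3 hy.
Let x4 : x ^+ 4 \is 4.-homog := dhomogMn 4 hx.
Let y4 : y ^+ 4 \is 4.-homog := dhomogMn 4 hy.

Lemma dhomog_quartic0 : quartic0 a%:MP x y \is 4.-homog.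
Proof.
apply: rpredD; first by apply: dhomog_C; exact: rpredD.
by apply: dhomog_nat; exact: (dhomogM x2 y2).
Qed.

Lemma dhomog_quartic1 : quartic1 a%:MP x y X Y \is 4.-homog.
Proof.
apply: rpredD; [apply: dhomog_C|apply: dhomog_nat]; apply: rpredB.
- exact: (dhomogM y3 hX).
- exact: (dhomogM x3 hY).
- exact: (dhomogM (dhomogM x2 hy) hX).
- exact: (dhomogM (dhomogM hx y2) hY).
Qed.

Lemma dhomog_quartic2 : quartic2 a%:MP x y X Y \is 4.-homog.
Proof.
apply: rpredD; first apply: dhomog_C; first apply: rpredD.
- exact: (dhomogM x2 Y2).
- exact: (dhomogM y2 X2).
apply: rpredB; first apply: rpredD.
- exact: (dhomogM x2 X2).
- exact: (dhomogM y2 Y2).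
by apply: dhomog_nat; exact: (dhomogM (dhomogM (dhomogM hx hy) hX) hY).
Qed.

Lemma dhomog_sextic : sextic x y \is 6.-homog.
Proof. by apply: (dhomogM (dhomogM hx hy)); exact: rpredB. Qed.

Lemma dhomog_pairing : x * X + y * Y \is 2.-homog.
Proof. by apply: rpredD; [exact: (dhomogM hx hX)|exact: (dhomogM hy hY)]. Qed.

End HomogeneousQuartic.

(** * The constants omega and sigma *)

Section Constants.
Variable R : realType.
Local Notation C := R[i].

Definition kappa : C := omega R / sqrtC 2%:R.
Definition i_sqrt3 : C := 'i * sqrtC 3%:R.

Lemma cisD (a b : R) : cis (a + b) = cis a * cis b.
Proof.
rewrite /cis trigo.cosD trigo.sinD; simpc. congr (_ +i* _)%C; exact: addrC.
Qed.

Lemma cisMn (a : R) n : cis (n%:R * a) = cis a ^+ n.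
Proof.
elim: n => [|n IH]; first by rewrite mul0r /cis trigo.cos0 trigo.sin0.
by rewrite -natr1 mulrDl mul1r cisD IH exprSr.
Qed.

Lemma sqrtC_nat_eq n (x : C) : 0 <= x -> x ^+ 2 = n%:R -> sqrtC n%:R = x.
Proof. by move=> x0 <-; exact: sqrCK. Qed.

Lemma iC2 : ('i : C) ^+ 2 = -1. Proof. exact: sqrCi. Qed.

Lemma omega6 : omega R ^+ 6 = 'i.
Proof.
rewrite /omega -cisMn (_ : 6%:R * (trigo.pi / 12%:R) = trigo.pi / 2%:R); last by field.
by rewrite /cis trigo.cos_pihalf trigo.sin_pihalf.
Qed.

Lemma omega_neq0 : omega R != 0.
Proof. by apply/eqP => h; move: omega6; rewrite h expr0n /= => /esym/eqP;
  rewrite (negPf (neq0Ci _)). Qed.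

(** omega ^+ 3 has angle pi / 4, where sine and cosine are equal. *)
Lemma sqrt2_omega3 : sqrtC 2%:R * omega R ^+ 3 = 1 + 'i.
Proof.
rewrite /omega -cisMn (_ : 3%:R * (trigo.pi / 12%:R) = trigo.pi / 4%:R); last by field.
set a := _ / 4%:R.
have a_gt0 : 0 < a by rewrite divr_gt0 ?trigo.pi_gt0.
have a_lt : a < trigo.pi / 2%:R.
  by rewrite ltr_pM2l ?trigo.pi_gt0 // ltf_pV2 ?posrE ?ltr0n // ltr_nat.
have c_gt0 : 0 < trigo.cos a.
  by rewrite trigo.cos_gt0_pihalf // a_lt (lt_trans _ a_gt0) // oppr_lt0 divr_gt0
    ?trigo.pi_gt0.
have sE : trigo.sin a = trigo.cos a.
  by have := trigo.tan_piquarter R; rewrite /trigo.tan -/a => /divr1_eq.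
have c2 := trigo.cos2Dsin2 a; rewrite sE -mulr2n in c2.
rewrite (@sqrtC_nat_eq 2 (2%:R * (trigo.cos a))%:C%C).
- by rewrite /cis sE; simpc; rewrite -mulrA -expr2 mulr_natl c2.
- by rewrite ler0c mulr_ge0 // ltW.
- rewrite -rmorphXn exprMn expr2 -mulrA [X in _ * X]mulr_natl c2 mulr1 rmorph_nat //.
Qed.

(** omega ^+ 4 is a primitive sixth root of unity. *)
Lemma omega8 : omega R ^+ 8 - omega R ^+ 4 + 1 = 0.
Proof.
rewrite [omega R ^+ 8](exprM _ 4 2).
rewrite /omega -cisMn (_ : 4%:R * (trigo.pi / 12%:R) = trigo.pi / 3%:R); last by field.
set a := _ / 3%:R; set Z := cis a.
have a_gt0 : 0 < a by rewrite divr_gt0 ?trigo.pi_gt0.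
have a_lt : a < trigo.pi.
  rewrite /a ltr_pdivrMr ?ltr0n // ltr_pMr ?trigo.pi_gt0 //.
  by rewrite (ltr_nat R 1 3).
have s_gt0 : 0 < trigo.sin a by rewrite trigo.sin_gt0_pi // a_gt0.
have Z3 : Z ^+ 3 = -1.
  rewrite -cisMn (_ : 3%:R * a = trigo.pi); last by rewrite /a; field.
  by rewrite /cis trigo.cospi trigo.sinpi; apply/eqP; rewrite eq_complex /= oppr0 !eqxx.
have Z1 : Z + 1 != 0.
  apply/eqP => /(congr1 (@complex.Im R)) /=; rewrite addr0 => h.
  by rewrite h ltxx in s_gt0.
by apply: (mulfI Z1); rewrite mulr0; ring: Z3.
Qed.

Lemma i_sqrt3_sqr : i_sqrt3 ^+ 2 = - 3%:R.
Proof. by rewrite /i_sqrt3 exprMn sqrCi sqrtCK mulN1r. Qed.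

Lemma sqrtC2_neq0 : sqrtC 2%:R != 0 :> C.
Proof. by rewrite sqrtC_eq0 pnatr_eq0. Qed.

Lemma kappa_sqr : 2%:R * kappa ^+ 2 = omega R ^+ 2.
Proof. by rewrite /kappa expr_div_n sqrtCK mulrC divfK // pnatr_eq0. Qed.

(** This is the equation saying that 1 is an eigenvalue of the matrix c. *)
Lemma kappa_quad : 2%:R * kappa ^+ 2 = (1 - 'i) * kappa + 'i.
Proof.
have w8 := omega8.
have h : (1 - 'i) * kappa * omega R ^+ 2 = 1.
  have : (1 - 'i) * kappa * omega R ^+ 2 * (sqrtC 2%:R) ^+ 2 = (1 - 'i) * (1 + 'i).
    by rewrite -sqrt2_omega3 /kappa; field; exact: sqrtC2_neq0.
  rewrite sqrtCK => e; apply: (@mulIf _ 2%:R); first by rewrite pnatr_eq0.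
  by rewrite e; ring: iC2.
apply: (@mulIf _ (omega R ^+ 2)); first by rewrite expf_neq0 ?omega_neq0.
rewrite [RHS]mulrDl h kappa_sqr -omega6; apply/eqP; rewrite -subr_eq0 -oppr_eq0 -w8.
by apply/eqP; ring.
Qed.

Lemma sigmaE : sigma R = 2%:R * 'i * kappa ^+ 2.
Proof.
rewrite mulrAC kappa_sqr -omega6 -exprD /omega -cisMn /sigma; congr cis; by field.
Qed.

Lemma sigma_quad : sigma R ^+ 2 + sigma R + 1 = 0.
Proof.
have w8 := omega8; rewrite sigmaE mulrAC kappa_sqr -omega6.
rewrite -[RHS](mulr0 (omega R ^+ 8 + omega R ^+ 4 + 1)) -w8; ring.
Qed.

Lemma sigma3 : sigma R ^+ 3 = 1.
Proof.
apply/eqP; rewrite -subr_eq0 -[X in _ == X](mulr0 (sigma R - 1)) -sigma_quad.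
by apply/eqP; ring.
Qed.

Lemma sigma_neq0 : sigma R != 0.
Proof. by apply/eqP => h; move: sigma3; rewrite h expr0n => /esym/eqP; rewrite oner_eq0. Qed.

Lemma sigma_neq1 : sigma R != 1.
Proof.
apply/eqP => h; move: sigma_quad; rewrite h expr1n => /eqP.
by rewrite -[1 + 1]/(2%:R) -(natrD _ 2 1) pnatr_eq0.
Qed.

Lemma kappa_neq0 : kappa != 0.
Proof. by rewrite mulf_neq0 ?invr_eq0 ?omega_neq0 ?sqrtC2_neq0. Qed.

End Constants.

(** * The action of G_5 on W and on its coordinate ring *)

Section GroupAction.
Variable R : realType.
Local Notation C := R[i].
Local Notation CW := {mpoly C[4]}.
Local Notation x_ := (coord_x R). Local Notation y_ := (coord_y R).
Local Notation X_ := (coord_X R). Local Notation Y_ := (coord_Y R).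
Implicit Types (g h : 'M[C]_2) (f : CW) (w : 'cV[C]_4).

Definition pt (x y X Y : C) : 'cV[C]_4 := \col_i nth 0 [:: x; y; X; Y] i.
Definition coords w (i : 'I_4) : C := w i 0.

Lemma eq_mx2 (p q r s p' q' r' s' : C) :
  p = p' -> q = q' -> r = r' -> s = s' -> mx2 p q r s = mx2 p' q' r' s'.
Proof. by move=> -> -> -> ->. Qed.

Lemma mx2M (p q r s p' q' r' s' : C) : mx2 p q r s *m mx2 p' q' r' s' =
  mx2 (p * p' + q * r') (p * q' + q * s') (r * p' + s * r') (r * q' + s * s').
Proof.
apply/matrixP => i j; rewrite !mxE big_ord_recl big_ord1 !mxE /=.
by case: i => [[|[]]] // ?; case: j => [[|[]]].
Qed.

Lemma mx2_1 : mx2 1 0 0 1 = 1%:M :> 'M[C]_2.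
Proof.
by apply/matrixP => i j; rewrite !mxE; case: i => [[|[]]] // ?; case: j => [[|[]]].
Qed.

Lemma mx2Z (c p q r s : C) : c *: mx2 p q r s = mx2 (c * p) (c * q) (c * r) (c * s).
Proof.
by apply/matrixP => i j; rewrite !mxE; case: i => [[|[]]] // ?; case: j => [[|[]]].
Qed.

Lemma mx2_unit (p q r s : C) : p * s - q * r != 0 -> mx2 p q r s \in unitmx.
Proof.
move=> d0; apply: (proj1 (@mulmx1_unit _ _ _ (((p * s - q * r)^-1) *: mx2 s (- q) (- r) p) _)).
by rewrite mx2Z mx2M -mx2_1; apply: eq_mx2; field.
Qed.

Lemma invmx2 (p q r s : C) : p * s - q * r != 0 ->
  invmx (mx2 p q r s) = (p * s - q * r)^-1 *: mx2 s (- q) (- r) p.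
Proof.
move=> d0; have u := mx2_unit d0.
apply: (can_inj (mulKmx u)); rewrite mulmxV // mx2Z mx2M -mx2_1.
by apply: eq_mx2; field.
Qed.

Lemma actW_mx2 (p q r s : C) (d := p * s - q * r) : d != 0 ->
  actW (mx2 p q r s) = \matrix_(i, j) nth 0 (nth [::]
    [:: [:: p; q; 0; 0]; [:: r; s; 0; 0];
        [:: 0; 0; s / d; - r / d]; [:: 0; 0; - q / d; p / d]] i) j.
Proof.
move=> d0; apply/matrixP => i j; rewrite /actW invmx2 // mx2Z -/d.
case: (@split_ordP 2 2 i) => i' ->; case: (@split_ordP 2 2 j) => j' ->;
  (etransitivity; [by first [exact: block_mxEul | exact: block_mxEur
                            | exact: block_mxEdl | exact: block_mxEdr]|]);
  rewrite !mxE; case: i' => [[|[]]] // ?; case: j' => [[|[]]] // ?;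
  by rewrite //= [LHS]mulrC.
Qed.

Lemma actW_pt (p q r s x y X Y : C) (d := p * s - q * r) : d != 0 ->
  actW (mx2 p q r s) *m pt x y X Y =
  pt (p * x + q * y) (r * x + s * y) ((s * X - r * Y) / d) ((p * Y - q * X) / d).
Proof.
move=> d0; rewrite actW_mx2 //; apply/matrixP => i j; rewrite !mxE.
rewrite !big_ord_recl big_ord0 !mxE /= -/d.
by case: i => [[|[|[|[]]]]] // ? /=; field.
Qed.

Lemma G5_unit g : G5 g -> g \in unitmx.
Proof.
elim => {g} [||||||g _ gu]; last by rewrite unitmx_inv.
- apply: mx2_unit; rewrite mulrN -expr2 sqrCi opprK mul0r subr0; exact: oner_neq0.
- apply: mx2_unit; rewrite mul0r mul1r sub0r opprK; exact: oner_neq0.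
- rewrite /matC -/(kappa R) mx2Z; apply: mx2_unit.
  rewrite (_ : _ - _ = 2%:R * 'i * kappa R ^+ 2); last by ring.
  by rewrite mulf_neq0 ?expf_neq0 ?kappa_neq0 ?mulf_neq0 ?neq0Ci ?pnatr_eq0.
- by apply: mx2_unit; rewrite mulr0 subr0 mulf_neq0 ?sigma_neq0.
- by rewrite unitmx1.
- by move=> g h _ gu _ hu; rewrite unitmx_mul gu.
Qed.

Lemma actWM g h : g \in unitmx -> h \in unitmx ->
  actW (g *m h) = actW g *m actW h.
Proof.
move=> gu hu; apply/esym; etransitivity;
  first exact: (@mulmx_block _ 2 2 2 2 2 2 g 0 0 (invmx g)^T h 0 0 (invmx h)^T).
rewrite !mul0mx !mulmx0 !addr0 add0r.
suff -> : (invmx g)^T *m (invmx h)^T = (invmx (g *m h))^T by [].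
have ghu : g *m h \in unitmx by rewrite unitmx_mul gu.
rewrite -trmx_mul; congr (_ ^T); apply: (can_inj (mulKmx ghu)).
by rewrite mulmxV // mulmxA -(mulmxA g) mulmxV // mulmx1 mulmxV.
Qed.

Lemma actW1 : actW 1%:M = 1%:M :> 'M[C]_4.
Proof. by rewrite /actW invmx1 trmx1 -(scalar_mx_block 2 2). Qed.

Lemma meval_act_poly g f w : (act_poly g f).@[coords w] = f.@[coords (actW g *m w)].
Proof.
rewrite comp_mpoly_meval; apply: meval_eq => i; rewrite tnth_mktuple /coords mxE.
rewrite raddf_sum; apply: eq_bigr => j _ /=.
by rewrite mevalZ mevalXU.
Qed.

Lemma act_polyM g h f : g \in unitmx -> h \in unitmx ->
  act_poly (g *m h) f = act_poly h (act_poly g f).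
Proof.
move=> gu hu.
pose s k : 4.-tuple CW := [tuple \sum_j actW k i j *: 'X_j | i < 4].
rewrite -[RHS]/(comp_mpoly (s h) (mmap (@mpolyC 4 C) (tnth (s g)) f)) rmorph_mmap.
apply: eq_mmap => [c|i] /=; first exact/esym/comp_mpolyC.
rewrite [LHS]tnth_mktuple [tnth (s g) i]tnth_mktuple.
rewrite (raddf_sum (comp_mpoly _)).
rewrite (actWM gu hu) /=.
under [RHS]eq_bigr => j _ do
  rewrite comp_mpolyZ comp_mpolyXU (nth_map (inord 0)) ?size_enum_ord // nth_ord_enum
    scaler_sumr.
rewrite exchange_big /=; apply: eq_bigr => j _; rewrite mxE scaler_suml.
by apply: eq_bigr => k _; rewrite scalerA.
Qed.

Lemma act_poly1 f : act_poly 1%:M f = f.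
Proof.
rewrite -[RHS]comp_mpoly_id; apply: eq_mmap => // i;
  rewrite !tnth_mktuple actW1 (bigD1 i) //= big1 ?addr0 ?mxE ?eqxx ?scale1r // => j ji.
by rewrite mxE eq_sym (negPf ji) scale0r.
Qed.

Lemma invariants_gen f : act_poly (matA R) f = f -> act_poly (matB R) f = f ->
  act_poly (matC R) f = f -> act_poly (matD R) f = f -> invariants f.
Proof.
move=> fa fb fc fd g.
elim=> {g} [||||| g h gG gf hG hf | g gG gf].
- exact: fa.
- exact: fb.
- exact: fc.
- exact: fd.
- exact: act_poly1.
- by rewrite (act_polyM _ (G5_unit gG) (G5_unit hG)) gf.
have gu := G5_unit gG; have gVu : invmx g \in unitmx by rewrite unitmx_inv.
by rewrite -{1}gf -(act_polyM _ gu gVu) (mulmxV gu) act_poly1.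
Qed.

HB.instance Definition _ g := GRing.RMorphism.copy (act_poly g)
  (comp_mpoly [tuple \sum_j actW g i j *: 'X_j | i < 4]).

Lemma act_polyC g c : act_poly g c%:MP = c%:MP.
Proof. exact: comp_mpolyC. Qed.

Lemma act_poly_coord (p q r s : C) (d := p * s - q * r) : d != 0 ->
  let a := act_poly (mx2 p q r s) in
  [/\ a x_ = p%:MP * x_ + q%:MP * y_, a y_ = r%:MP * x_ + s%:MP * y_,
      a X_ = (s / d)%:MP * X_ + (- r / d)%:MP * Y_
    & a Y_ = (- q / d)%:MP * X_ + (p / d)%:MP * Y_].
Proof.
move=> d0 a.
have E i : (i < 4)%N -> a 'X_(inord i) = \sum_(j < 4) nth 0 (nth [::]
    [:: [:: p; q; 0; 0]; [:: r; s; 0; 0];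
        [:: 0; 0; s / d; - r / d]; [:: 0; 0; - q / d; p / d]] i) j *: 'X_(inord j).
  move=> i4; rewrite /a /act_poly comp_mpolyXU (nth_map (inord 0)) ?size_enum_ord //.
  rewrite nth_ord_enum actW_mx2 //; apply: eq_bigr => j _.
  by rewrite mxE inordK // inord_val.
by split; rewrite E // !big_ord_recl big_ord0 /= !scale0r ?add0r ?addr0 !mul_mpolyC.
Qed.

End GroupAction.

(** * Gradients of invariants at fixed points and eigenvectors *)

Section PolyRoots.
Variable F : fieldType.

Lemma dvdp_sqr_XsubC (p : {poly F}) a :
  root p a -> root p^`() a -> ('X - a%:P) ^+ 2 %| p.
Proof.
move=> /factor_theorem[q ->]; rewrite derivM derivXsubC mulr1.
rewrite rootE !hornerE subrr mulr0 add0r -rootE => /factor_theorem[q' ->].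
by rewrite -mulrA -expr2 dvdp_mulIr.
Qed.

Lemma dvdp_prod_sqr_XsubC (p : {poly F}) (s : seq F) : uniq s ->
  {in s, forall a, root p a /\ root p^`() a} ->
  (\prod_(a <- s) ('X - a%:P)) ^+ 2 %| p.
Proof.
elim: s => [|a s IH] /=; first by rewrite big_nil expr1n dvd1p.
move=> /andP[nas us] h; rewrite big_cons exprMn Gauss_dvdp; last first.
  rewrite coprimep_expl ?coprimep_expr // coprimep_sym coprimep_XsubC.
  by rewrite root_prod_XsubC.
have [ra rda] := h a (mem_head _ _); rewrite dvdp_sqr_XsubC // IH // => b bs.
by apply: h; rewrite inE bs orbT.
Qed.

End PolyRoots.

Lemma poly_eq0_horner (F : numFieldType) (p : {poly F}) : (forall a, p.[a] = 0) -> p = 0.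
Proof.
move=> h; apply: (@roots_geq_poly_eq0 _ p [seq i%:R | i <- iota 0 (size p)]).
- by apply/allP => a _; apply/rootP/h.
- by rewrite map_inj_uniq ?iota_uniq //; apply: mulrIn; exact: oner_neq0.
- by rewrite size_map size_iota.
Qed.

Section Directional.
Variable R : realType.
Local Notation C := R[i].
Local Notation CW := {mpoly C[4]}.
Implicit Types (g h : 'M[C]_2) (f r : CW) (w u v : 'cV[C]_4).

Definition line w u (i : 'I_4) : {poly C} := (w i 0)%:P + (u i 0) *: 'X.

Definition dir_deriv f w u : C := \sum_i f^`M(i).@[coords w] * u i 0.

Lemma horner_line w u i a : (line w u i).[a] = coords (w + a *: u) i.
Proof. by rewrite /line !hornerE /coords !mxE mulrC. Qed.

Lemma horner_pull_line f w u a : (pull (line w u) f).[a] = f.@[coords (w + a *: u)].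
Proof. by rewrite horner_pull; apply: meval_eq => i; rewrite horner_line. Qed.

Lemma deriv_pull_line f w u a :
  (pull (line w u) f)^`().[a] = dir_deriv f (w + a *: u) u.
Proof.
rewrite deriv_pull horner_sum; apply: eq_bigr => i _.
rewrite hornerM horner_pull_line; congr (_ * _).
by rewrite /line derivD derivC derivZ derivX add0r hornerZ hornerC mulr1.
Qed.

Lemma size_pull_line d f w u : f \is d.-homog -> (size (pull (line w u) f) <= d.+1)%N.
Proof.
move=> hf; apply: size_pull => // i; rewrite /line (leq_trans (size_polyD _ _)) //.
rewrite geq_max (leq_trans (size_polyC_leq1 _)) //.
by rewrite (leq_trans (size_scale_leq _ _)) ?size_polyX.
Qed.

Lemma dir_derivD f w u v : dir_deriv f w (u + v) = dir_deriv f w u + dir_deriv f w v.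
Proof. by rewrite /dir_deriv -big_split; apply: eq_bigr => i _; rewrite mxE mulrDr. Qed.

Lemma dir_deriv0 f w : dir_deriv f w 0 = 0.
Proof. by rewrite /dir_deriv big1 // => i _; rewrite mxE mulr0. Qed.

Lemma pull_line_act g f w u : act_poly g f = f ->
  pull (line (actW g *m w) (actW g *m u)) f = pull (line w u) f.
Proof.
move=> gf; rewrite -[in RHS]gf pull_comp_mpoly; apply: eq_pull => i.
rewrite tnth_mktuple rmorph_sum /line !mxE rmorph_sum scaler_suml -big_split /=.
apply: eq_bigr => j _; rewrite pullZ pullX scalerDr scalerA.
by rewrite polyCM mul_polyC.
Qed.

Lemma dir_deriv_act g f w u : act_poly g f = f ->
  dir_deriv f (actW g *m w) (actW g *m u) = dir_deriv f w u.
Proof.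
move=> gf; have := deriv_pull_line f w u 0; rewrite -(pull_line_act _ _ gf).
by rewrite deriv_pull_line !scale0r !addr0.
Qed.

Lemma meval_act g f w : act_poly g f = f -> f.@[coords (actW g *m w)] = f.@[coords w].
Proof. by move=> gf; rewrite -meval_act_poly gf. Qed.

Lemma meval_scale d f w c : f \is d.-homog -> f.@[coords (c *: w)] = c ^+ d * f.@[coords w].
Proof.
move=> hf; rewrite -(mmap_scale _ _ _ hf); apply: meval_eq => i.
by rewrite /coords mxE.
Qed.

Lemma dir_deriv_scale d f w u c : f \is d.-homog ->
  c * dir_deriv f (c *: w) u = c ^+ d * dir_deriv f w u.
Proof.
move=> hf; have <- : dir_deriv f (c *: w) (c *: u) = c * dir_deriv f (c *: w) u.
  by rewrite /dir_deriv mulr_sumr; apply: eq_bigr => i _; rewrite mxE mulrCA.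
have := deriv_pull_line f (c *: w) (c *: u) 0; rewrite scale0r addr0 => <-.
rewrite (@eq_pull _ _ _ (fun i => c%:P * line w u i)); last first.
  by move=> i; rewrite /line !mxE mulrDr -polyCM mul_polyC scalerA.
rewrite (pull_scale _ _ hf) -polyC_exp mul_polyC derivZ hornerZ.
by rewrite deriv_pull_line scale0r addr0.
Qed.

(** Homogeneity gives f (g w) = c^d f w, invariance f (g w) = f w. *)
Lemma eigenvector_vanish d g f w c : f \is d.-homog -> act_poly g f = f ->
  actW g *m w = c *: w -> c ^+ d != 1 -> f.@[coords w] = 0.
Proof.
move=> hf gf gw cd; have /eqP := meval_act w gf; rewrite gw (meval_scale _ _ hf).
by rewrite -subr_eq0 -{2}[f.@[_]]mul1r -mulrBl mulf_eq0 subr_eq0 (negPf cd) => /eqP.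
Qed.

(** As c^d = c, the derivative of f at w takes the same value on u, g u and
    g^2 u. *)
Lemma dir_deriv_average d g f w c u : f \is d.-homog -> act_poly g f = f ->
  actW g *m w = c *: w -> c != 0 -> c ^+ d = c ->
  dir_deriv f w (u + actW g *m u + actW g *m (actW g *m u)) = 0 -> dir_deriv f w u = 0.
Proof.
move=> hf gf gw c0 cd.
have E v : dir_deriv f w (actW g *m v) = dir_deriv f w v.
  rewrite -[RHS](dir_deriv_act _ _ gf) gw; apply: (mulfI c0).
  by rewrite (dir_deriv_scale _ _ _ hf) cd.
rewrite !dir_derivD !E -mulr2n -mulrSr => /eqP; rewrite mulrn_eq0 /= => /eqP //.
Qed.

(** For g of order three, v = u + g u + g^2 u is fixed by g, so r vanishes on
    the whole line of fixed points w + a v. *)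
Lemma sing_ideal_gradient d g r w u : r \is d.-homog -> sing_ideal r -> G5 g ->
  g <> 1%:M -> actW g *m actW g *m actW g = 1%:M -> actW g *m w = w ->
  dir_deriv r w u = 0.
Proof.
move=> hr [rinv rv] gG g1 g3 gw.
apply: (@dir_deriv_average d g _ _ 1) => //; rewrite ?scale1r ?oner_neq0 ?expr1n //.
  exact: rinv.
set v := (_ + _ : 'cV[C]_4).
have gv : actW g *m v = v.
  by rewrite /v !mulmxDr !mulmxA g3 mul1mx [LHS]addrC addrA.
have <- : (pull (line w v) r)^`().[0] = dir_deriv r w v.
  by rewrite deriv_pull_line scale0r addr0.
suff -> : pull (line w v) r = 0 by rewrite deriv0 horner0.
apply: poly_eq0_horner => a; rewrite horner_pull_line; apply: rv.
by exists g; split=> //; rewrite mulmxDr gw -scalemxAr gv.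
Qed.

End Directional.

(** * Homogeneous components of invariants *)

Section Homogeneous.
Variable R : realType.
Local Notation C := R[i].
Local Notation CW := {mpoly C[4]}.
Implicit Types (g : 'M[C]_2) (f r : CW).

Lemma dhomog_act g d f : f \is d.-homog -> act_poly g f \is d.-homog.
Proof.
apply: dhomog_comp => i; rewrite tnth_mktuple; apply: rpred_sum => j _.
by apply: rpredZ; rewrite dhomogX /= mdeg1.
Qed.

Lemma act_pihomog g d f : act_poly g (pihomog mdeg d f) = pihomog mdeg d (act_poly g f).
Proof.
pose k := maxn (msize f) d.+1; have dk : (d < k)%N by rewrite leq_maxr.
have fE := pihomog_partition_leq (leq_maxl _ d.+1 : (msize f <= k)%N).
have -> : act_poly g f = \sum_(j < k) act_poly g (pihomog mdeg j f).
  by rewrite {1}fE; exact: (raddf_sum (act_poly g)).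
rewrite [RHS](raddf_sum (pihomog mdeg d)) [RHS](bigD1 (Ordinal dk)) //=.
rewrite [X in _ = _ + X]big1 ?addr0.
  exact/esym/pihomog_dE/dhomog_act/pihomogP.
move=> j jd; apply: (@pihomog_ne0 _ _ _ j); last exact/dhomog_act/pihomogP.
by apply: contraNneq jd => jd; apply/eqP/val_inj.
Qed.

Lemma invariants_pihomog d f : invariants f -> invariants (pihomog mdeg d f).
Proof. by move=> hf g gG; rewrite act_pihomog hf. Qed.

(** The points with non-trivial stabiliser form a cone. *)
Lemma sing_ideal_pihomog d r : sing_ideal r -> sing_ideal (pihomog mdeg d r).
Proof.
move=> [rinv rv]; split; first exact: invariants_pihomog.
move=> w [g [gG g1 gw]].
pose k := maxn (msize r) d.+1; have dk : (d < k)%N by rewrite leq_maxr.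
pose p : {poly C} := \poly_(j < k) (pihomog mdeg j r).@[coords w].
(* the value of p at a is r (a w) *)
suff p0 : p = 0 by move: (coef_poly k (fun j => (pihomog mdeg j r).@[coords w]) d);
  rewrite dk -/p p0 coef0.
apply: poly_eq0_horner => a; rewrite horner_poly.
transitivity (r.@[coords (a *: w)]); last first.
  by apply: rv; exists g; split=> //; rewrite -scalemxAr gw.
rewrite [in RHS](pihomog_partition_leq (leq_maxl _ d.+1 : (msize r <= k)%N)).
rewrite raddf_sum; apply: eq_bigr => j _ /=.
by rewrite (meval_scale _ _ (pihomogP _ _ _)) mulrC.
Qed.

End Homogeneous.

(** * Reflections of order three in G_5 *)

Section Reflections.
Variable R : realType.
Local Notation C := R[i].
Local Notation i_ := ('i : C).
Local Notation kappa := (kappa R).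
Local Notation sigma := (sigma R).

Lemma eq_pt (x y X Y x' y' X' Y' : C) :
  x = x' -> y = y' -> X = X' -> Y = Y' -> pt x y X Y = pt x' y' X' Y'.
Proof. by move=> -> -> -> ->. Qed.

Lemma ptD (x y X Y x' y' X' Y' : C) :
  pt x y X Y + pt x' y' X' Y' = pt (x + x') (y + y') (X + X') (Y + Y').
Proof.
apply/matrixP => i j; rewrite !mxE.
by case: i => [[|[|[|[|[]]]]]].
Qed.

Lemma ptZ (c x y X Y : C) : c *: pt x y X Y = pt (c * x) (c * y) (c * X) (c * Y).
Proof.
apply/matrixP => i j; rewrite !mxE.
by case: i => [[|[|[|[|[]]]]]].
Qed.

Lemma pt_surj (w : 'cV[C]_4) : exists x y X Y, w = pt x y X Y.
Proof.
exists (w (inord 0) 0), (w (inord 1) 0), (w (inord 2) 0), (w (inord 3) 0).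
apply/matrixP => i j; rewrite !mxE (ord1 j).
by case: i => [[|[|[|[|[]]]]]] // i4 /=; congr (w _ 0); apply: val_inj; rewrite /= inordK.
Qed.

(** The matrix c with the scalar l instead of kappa, and, for e = -1, its
    conjugate by a. *)
Definition refl_mx (l e : C) : 'M[C]_2 := mx2 l (- (e * l)) (e * i_ * l) (i_ * l).

Lemma det_refl_mx l e : e ^+ 2 = 1 ->
  l * (i_ * l) - (- (e * l)) * (e * i_ * l) = 2%:R * i_ * l ^+ 2.
Proof. by move=> e2; ring : e2. Qed.

Lemma det_refl_mx_neq0 l e : e ^+ 2 = 1 -> l != 0 ->
  l * (i_ * l) - (- (e * l)) * (e * i_ * l) != 0.
Proof.
move=> e2 l0; rewrite det_refl_mx // mulf_neq0 ?expf_neq0 // mulf_neq0 ?neq0Ci //.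
by rewrite pnatr_eq0.
Qed.

(** The scalars for which [refl_mx l e] is a reflection: its characteristic
    polynomial vanishes at 1. *)
Definition refl_scalar (l : C) := 2%:R * l ^+ 2 = (1 - i_) * l + i_.

(** The slope x / y, for e = 1, of the vectors fixed by the reflection. *)
Definition axis (l : C) : C := - i_ - 2%:R * l.

(** The relation is monic in m = 2 l, which makes it a rewriting rule for
    polynomial identities. *)
Lemma refl_scalarE l : refl_scalar l ->
  exists2 m, l = m / 2%:R & m ^+ 2 = (1 - i_) * m + 2%:R * i_.
Proof.
move=> l2; exists (2%:R * l); first by rewrite [2%:R * _]mulrC mulfK // pnatr_eq0.
by rewrite exprMn expr2 -mulrA l2; ring.
Qed.

Lemma refl_mx_axis l e : refl_scalar l -> l != 0 -> e ^+ 2 = 1 ->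
  actW (refl_mx l e) *m pt (e * axis l) 1 (e * axis l) i_ = pt (e * axis l) 1 (e * axis l) i_.
Proof.
move=> /refl_scalarE[m lE m2] l0 e2; have d0 := det_refl_mx_neq0 e2 l0.
have i2 := iC2 R; rewrite lE in d0 *.
rewrite /refl_mx actW_pt //; apply: eq_pt.
- by rewrite /axis; field : m2 i2 e2.
- by rewrite /axis; field : m2 i2 e2.
- by apply: (mulIf d0); rewrite divfK // /axis; field : m2 i2 e2.
- by apply: (mulIf d0); rewrite divfK // /axis; field : m2 i2 e2.
Qed.

Lemma refl_mx_cube l e : refl_scalar l -> e ^+ 2 = 1 ->
  refl_mx l e *m refl_mx l e *m refl_mx l e = 1%:M.
Proof.
move=> /refl_scalarE[m -> m2] e2; have i2 := iC2 R.
by rewrite /refl_mx !mx2M -mx2_1; apply: eq_mx2; field : m2 i2 e2.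
Qed.

Lemma refl_mx_neq1 l e : l != 0 -> e ^+ 2 = 1 -> refl_mx l e <> 1%:M.
Proof.
move=> l0 e2 /matrixP/(_ 0 1); rewrite !mxE /= => /eqP.
rewrite oppr_eq0 mulf_eq0 (negPf l0) orbF => /eqP e0.
by move: e2; rewrite e0 expr0n => /esym/eqP; rewrite oner_eq0.
Qed.

Lemma matC_refl_mx : matC R = refl_mx kappa 1.
Proof. by rewrite /matC -/kappa mx2Z; apply: eq_mx2; ring. Qed.

Lemma matA_refl_mx l e : matA R *m refl_mx l e *m (matA R *m matA R *m matA R) =
  refl_mx l (- e).
Proof.
by have i2 := iC2 R; rewrite !mx2M; apply: eq_mx2; ring : i2.
Qed.

Lemma matD_refl_mx l e : matD R *m refl_mx l e = refl_mx (sigma * l) e.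
Proof. by rewrite mx2M; apply: eq_mx2; ring. Qed.

Lemma G5_refl_mx l e : G5 (refl_mx l 1) -> e ^+ 2 = 1 -> G5 (refl_mx l e).
Proof.
move=> G1 /eqP; rewrite sqrf_eq1 => /orP[] /eqP -> //.
rewrite -matA_refl_mx; have Ga := G5_a R.
by apply: (G5_mul (G5_mul Ga G1)); apply: (G5_mul (G5_mul Ga Ga)).
Qed.

(** The scalar for which [refl_mx l e] has determinant 1 and trace -1, hence
    order three in SL_2. *)
Definition sl_scalar : C := (i_ - 1) / 2%:R.

Lemma refl_scalar_kappa : refl_scalar kappa.
Proof. exact: kappa_quad. Qed.

Lemma sigma_kappa : sigma * kappa = sl_scalar.
Proof.
have [m lE m2] := refl_scalarE refl_scalar_kappa; have i2 := iC2 R.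
by rewrite sigmaE lE /sl_scalar; field : m2 i2.
Qed.

Lemma sl_scalar_neq0 : sl_scalar != 0.
Proof. by rewrite -sigma_kappa mulf_neq0 ?sigma_neq0 ?kappa_neq0. Qed.

Lemma refl_scalar_kappa2 : refl_scalar (sigma * sl_scalar).
Proof.
have [m lE m2] := refl_scalarE refl_scalar_kappa; have i2 := iC2 R.
by rewrite /refl_scalar sigmaE lE /sl_scalar; field : m2 i2.
Qed.

Lemma G5_refl_mx_kappa : G5 (refl_mx kappa 1).
Proof. rewrite -matC_refl_mx; exact: G5_c. Qed.

Lemma G5_refl_mx_sl : G5 (refl_mx sl_scalar 1).
Proof. by rewrite -sigma_kappa -matD_refl_mx; apply: G5_mul (G5_d R) G5_refl_mx_kappa. Qed.

Lemma G5_refl_mx_kappa2 : G5 (refl_mx (sigma * sl_scalar) 1).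
Proof. by rewrite -matD_refl_mx; apply: G5_mul (G5_d R) G5_refl_mx_sl. Qed.

(** On the plane of vectors (v, s J v), isomorphic to V as a representation of
    SL_2, the axes of the reflections are eigenvectors. *)
Lemma refl_mx_sl_axis l c s e : refl_scalar l -> c * l = sl_scalar -> e ^+ 2 = 1 ->
  actW (refl_mx sl_scalar e) *m pt (e * axis l) 1 s (- s * (e * axis l)) =
  c *: pt (e * axis l) 1 s (- s * (e * axis l)).
Proof.
move=> /refl_scalarE[m lE m2] cl e2; have d0 := det_refl_mx_neq0 e2 sl_scalar_neq0.
have i2 := iC2 R.
have d1 : 2%:R * i_ * sl_scalar ^+ 2 = 1 by rewrite /sl_scalar; field : i2.
rewrite /refl_mx actW_pt // det_refl_mx // d1 !divr1 ptZ -cl lE; apply: eq_pt;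
  by rewrite /axis; field : m2 i2 e2.
Qed.

(** The eigenvalues on W are the two primitive cube roots of unity. *)
Lemma refl_mx_sl_trace e (u : 'cV[C]_4) : e ^+ 2 = 1 ->
  u + actW (refl_mx sl_scalar e) *m u
    + actW (refl_mx sl_scalar e) *m (actW (refl_mx sl_scalar e) *m u) = 0.
Proof.
move=> e2; have [x [y [X [Y ->]]]] := pt_surj u.
have d0 := det_refl_mx_neq0 e2 sl_scalar_neq0; have i2 := iC2 R.
have d1 : 2%:R * i_ * sl_scalar ^+ 2 = 1 by rewrite /sl_scalar; field : i2.
rewrite /refl_mx !actW_pt // det_refl_mx // d1 !divr1 !ptD.
have <- : 0 *: pt 0 0 0 0 = 0 :> 'cV[C]_4 by rewrite scale0r.
by rewrite ptZ mul0r; apply: eq_pt; rewrite /sl_scalar; field : i2 e2.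
Qed.

End Reflections.

(** * Invariants on two planes of W *)

Section Plane.
Variable R : realType.
Local Notation C := R[i].
Local Notation CW := {mpoly C[4]}.
Local Notation i_ := ('i : C).
Local Notation kappa := (kappa R).
Local Notation sigma := (sigma R).
Local Notation kappa2 := (sigma * sl_scalar R).
Implicit Types (g : 'M[C]_2) (f r : CW).

(** The restriction of G_{2,2}, and of its conjugate, to the points
    (u, 1, u, i) of W, with u the variable. *)
Definition qpoly : {poly C} := 'X^4 - (4%:R * i_) *: 'X^2 - 1.

(** The parameter at which the next two lines meet. *)
Definition xi0 : C := sqrtC (- i_).

(** Restriction to the points (u, 1, u, i), the chart y = 1 of a plane of W that
    meets the fixed planes of four reflections of order three along lines. *)
Definition on_plane f := pull (line (pt 0 1 0 i_) (pt 1 0 1 0)) f.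

(** Restriction to the points (u, 1, xi0, - xi0 u), where xX + yY vanishes. *)
Definition on_null f := pull (line (pt 0 1 xi0 0) (pt 1 0 0 (- xi0))) f.

Lemma xi0_sqr : xi0 ^+ 2 = - i_. Proof. exact: sqrtCK. Qed.

Lemma kappa2E : exists2 m, m ^+ 2 = (1 - i_) * m + 2%:R * i_ &
  axis kappa = - i_ - m /\ axis kappa2 = m - 1.
Proof.
have [m lE m2] := refl_scalarE (refl_scalar_kappa R); exists m => //.
have i2 := iC2 R; rewrite /axis sigmaE lE /sl_scalar.
by split; field : m2 i2.
Qed.

Lemma axis_sum : axis kappa ^+ 2 + axis kappa2 ^+ 2 = 4%:R * i_.
Proof. by have [m m2 [-> ->]] := kappa2E; have i2 := iC2 R; ring : m2 i2. Qed.

Lemma axis_prod : axis kappa ^+ 2 * axis kappa2 ^+ 2 = -1.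
Proof. by have [m m2 [-> ->]] := kappa2E; have i2 := iC2 R; ring : m2 i2. Qed.

Definition axes : seq C := [:: axis kappa; - axis kappa; axis kappa2; - axis kappa2].

Lemma qpolyE : qpoly = \prod_(a <- axes) ('X - a%:P).
Proof.
have -> : qpoly = 'X^4 - (axis kappa ^+ 2 + axis kappa2 ^+ 2)%:P * 'X^2
    + (axis kappa ^+ 2 * axis kappa2 ^+ 2)%:P.
  by rewrite axis_sum axis_prod polyCN mul_polyC.
rewrite /axes !big_cons big_nil !polyCN mulr1 polyCD polyCM !polyC_exp; ring.
Qed.

Lemma axes_uniq : uniq axes.
Proof.
have n1 : (1 : C) != 0 by exact: oner_neq0.
have sq0 (a b : C) : a ^+ 2 * b ^+ 2 = -1 -> a != 0.
  by apply: contra_eq_neq => ->; rewrite expr0n mul0r eq_sym oppr_eq0.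
have a0 := sq0 _ _ axis_prod; have b0 : axis kappa2 != 0.
  by apply: (sq0 _ (axis kappa)); rewrite mulrC axis_prod.
have N (a : C) : a != 0 -> a != - a.
  by move=> an0; rewrite -subr_eq0 opprK -mulr2n mulrn_eq0.
have ab : axis kappa ^+ 2 != axis kappa2 ^+ 2.
  apply/eqP => e; have := axis_prod; have := axis_sum; rewrite -e -mulr2n => h1 h2.
  (* 4 a^2 b^2 = (a^2 + b^2)^2 reads - 4 = - 16 *)
  have h3 : (12%:R : C) = 0.
    have <- : 4%:R * (axis kappa ^+ 2 * axis kappa ^+ 2) - (axis kappa ^+ 2 *+ 2) ^+ 2 = 0.
      by ring.
    by have i2 := iC2 R; rewrite h1 -expr2 expr2 h2; ring : i2.
  by move/eqP: h3; rewrite pnatr_eq0.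
rewrite /axes /= !inE !negb_or !N // eqr_opp -![_ == - _]eqr_oppLR ?opprK.
have ne (a b : C) : a ^+ 2 != b ^+ 2 -> (a != b) /\ (- a != b).
  by move=> h; split; apply: contra h => /eqP <-; rewrite ?sqrrN.
have [h1 h2] := ne _ _ ab; rewrite !andbT h1 h2 /=.
rewrite ?h1 ?h2 ?eqr_oppLR //=.
Qed.

Lemma mem_axes a : a \in axes -> exists l e, [/\ refl_scalar l, l != 0, e ^+ 2 = 1,
  a = e * axis l & (l = kappa \/ l = kappa2)].
Proof.
have k0 := kappa_neq0 R.
have k20 : kappa2 != 0 by rewrite mulf_neq0 ?sigma_neq0 ?sl_scalar_neq0.
have s1 := refl_scalar_kappa R; have s2 := refl_scalar_kappa2 R.
rewrite !inE => /or4P[] /eqP ->; [exists kappa, 1|exists kappa, (-1)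
  |exists kappa2, 1|exists kappa2, (-1)];
  by split; rewrite ?mul1r ?mulN1r ?sqrrN ?expr1n //; first [by left | by right].
Qed.

Lemma on_plane_point a : pt 0 1 0 i_ + a *: pt 1 0 1 0 = pt a 1 a i_.
Proof. by rewrite ptZ ptD; apply: eq_pt; ring. Qed.

Lemma on_null_point a :
  pt 0 1 xi0 0 + a *: pt 1 0 0 (- xi0) = pt a 1 xi0 (- xi0 * a).
Proof. by rewrite ptZ ptD; apply: eq_pt; ring. Qed.

(** Each root of [qpoly] is the parameter of a point fixed by a reflection of
    order three, so it is a double root of the restriction of r. *)
Lemma sing_ideal_on_plane d r : r \is d.-homog -> sing_ideal r ->
  qpoly ^+ 2 %| on_plane r.
Proof.
move=> hr rI; rewrite qpolyE; apply: dvdp_prod_sqr_XsubC axes_uniq _ => a.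
move=> /mem_axes[l [e [lr l0 e2 -> lk]]].
have lG : G5 (refl_mx l e).
  by apply: G5_refl_mx e2; case: lk => ->; [exact: G5_refl_mx_kappa|exact: G5_refl_mx_kappa2].
have gw := refl_mx_axis lr l0 e2; have g1 := refl_mx_neq1 l0 e2.
split; rewrite rootE.
  by rewrite horner_pull_line on_plane_point rI.2 //; exists (refl_mx l e).
rewrite deriv_pull_line on_plane_point (sing_ideal_gradient _ hr rI lG g1 _ gw) //.
have gu := G5_unit lG; have ggu : refl_mx l e *m refl_mx l e \in unitmx by rewrite
  unitmx_mul gu.
by rewrite -(actWM gu gu) -(actWM ggu gu) refl_mx_cube // actW1.
Qed.

(** Each axis is an eigenvector, with a primitive cube root of unity c as
    eigenvalue, of an element g of order three of SL_2. As c^10 = c differs from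
    1, both r and, since 1 + g + g^2 = 0, its gradient vanish there. *)
Lemma invariants_on_null r : r \is 10.-homog -> invariants r ->
  qpoly ^+ 2 %| on_null r.
Proof.
move=> hr rinv; rewrite qpolyE; apply: dvdp_prod_sqr_XsubC axes_uniq _ => a.
move=> /mem_axes[l [e [lr l0 e2 -> lk]]].
have [c [cl c0 c10 c1]] : exists c, [/\ c * l = sl_scalar R, c != 0, c ^+ 10 = c & c != 1].
  have s3 := sigma3 R; have s0 := sigma_neq0 R; have s1 := sigma_neq1 R.
  case: lk => ->.
    by exists sigma; split; rewrite ?sigma_kappa //; ring : s3.
  exists (sigma ^+ 2); split; rewrite ?expf_neq0 //; [by ring : s3|by ring : s3|].
  by apply: contra s1 => /eqP h; rewrite -s3 exprS h mulr1.
have rg : act_poly (refl_mx (sl_scalar R) e) r = r.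
  by apply: rinv; apply: G5_refl_mx e2; exact: G5_refl_mx_sl.
have gw := refl_mx_sl_axis xi0 lr cl e2.
split; rewrite rootE.
  rewrite horner_pull_line on_null_point.
  by rewrite (eigenvector_vanish hr rg gw) // c10.
rewrite deriv_pull_line on_null_point (dir_deriv_average hr rg gw c0 c10) //.
by rewrite refl_mx_sl_trace // dir_deriv0.
Qed.

(** The parameters 0, 1 and -1 are eigenvectors of a and of ab with eigenvalues
    i or - i, whose powers in degrees 2 modulo 4 are -1. *)
Lemma invariants_on_null_roots k r : r \is (4 * k + 2).-homog -> invariants r ->
  all (root (on_null r)) [:: 0; 1; -1].
Proof.
move=> hr rinv; have i2 := iC2 R.
have nz : (2%:R : C) != 0 by rewrite pnatr_eq0.
have cd (c : C) : c ^+ 2 = -1 -> c ^+ (4 * k + 2) != 1.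
  move=> c2; rewrite exprD -[4%N]/(2 * 2)%N -mulnA exprM c2 exprM sqrrN !expr1n mul1r.
  by rewrite -subr_eq0 -opprD oppr_eq0.
have E e : e ^+ 2 = 1 -> root (on_null r) e.
  move=> e2; rewrite rootE horner_pull_line on_null_point.
  rewrite (@eigenvector_vanish _ _ (matA R *m matB R) _ _ (i_ * e) hr) //.
  - by apply: rinv; apply: G5_mul; [exact: G5_a|exact: G5_b].
  - rewrite mx2M (_ : mx2 _ _ _ _ = mx2 0 i_ i_ 0); last by apply: eq_mx2; ring.
    have d1 : 0 * 0 - i_ * i_ = 1 by ring : i2.
    by rewrite actW_pt d1 ?oner_neq0 // !divr1 ptZ; apply: eq_pt; ring : i2 e2.
  - by apply: cd; ring : i2 e2.
rewrite /= (E 1) ?expr1n // (E (-1)) ?sqrrN ?expr1n // !andbT.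
rewrite rootE horner_pull_line on_null_point.
rewrite (@eigenvector_vanish _ _ (matA R) _ _ (- i_) hr) //.
- by apply: rinv; exact: G5_a.
- have d1 : i_ * (- i_) - 0 * 0 = 1 by ring : i2.
  by rewrite actW_pt d1 ?oner_neq0 // !divr1 ptZ; apply: eq_pt; ring : i2.
- by apply: cd; rewrite sqrrN.
Qed.

Lemma uniq_01N1 : uniq [:: 0; 1; -1 : C].
Proof.
rewrite /= !inE negb_or eq_sym oner_neq0 eq_sym oppr_eq0 oner_neq0 /= andbT.
by rewrite -subr_eq0 opprK -mulr2n pnatr_eq0.
Qed.

Lemma horner_qpoly a : qpoly.[a] = a ^+ 4 - 4%:R * i_ * a ^+ 2 - 1.
Proof. by rewrite !hornerE /=; ring. Qed.

Lemma size_qpoly : size qpoly = 5%N.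
Proof. by rewrite qpolyE size_prod_XsubC. Qed.

Lemma qpoly_neq0 : qpoly != 0.
Proof. by rewrite -size_poly_gt0 size_qpoly. Qed.

Lemma size_qpoly_sqr (p : {poly C}) : p != 0 ->
  size (qpoly ^+ 2 * p) = (size p + 8)%N.
Proof.
move=> p0; have qm : qpoly \is monic by rewrite qpolyE monic_prod_XsubC.
have qp : qpoly * p != 0 by rewrite mulf_neq0 ?qpoly_neq0.
by rewrite expr2 -mulrA size_monicM // size_monicM // size_qpoly !addSn !add0n /=
  [RHS]addnC !addSn add0n.
Qed.

(** Degree 2 has room for two roots only, and degree 10 for the square of
    [qpoly] and two more. *)
Lemma on_null_eq0 d r : r \is d.-homog -> invariants r -> (d = 2 \/ d = 10)%N ->
  on_null r = 0.
Proof.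
move=> hr rinv [] dE; rewrite dE in hr.
  apply: (roots_geq_poly_eq0 (@invariants_on_null_roots 0 r hr rinv) uniq_01N1).
  exact: size_pull_line hr.
have /dvdpP[p pE] := invariants_on_null hr rinv; rewrite mulrC in pE.
have [p0|p0] := eqVneq p 0; first by rewrite pE p0 mulr0.
have sp : (size p <= 3)%N.
  by have := size_pull_line (pt 0 1 xi0 0) (pt 1 0 0 (- xi0)) hr;
    rewrite -/(on_null r) pE size_qpoly_sqr // -[11%N]/(3 + 8)%N leq_add2r.
suff p00 : p = 0 by rewrite p00 eqxx in p0.
apply: roots_geq_poly_eq0 uniq_01N1 sp.
have /allP h := @invariants_on_null_roots 2 r hr rinv; apply/allP => a aN.
have := h a aN; rewrite pE rootM => /orP[|//]; rewrite expr2 rootM orbb.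
rewrite rootE horner_qpoly => qa; exfalso; move: qa; apply/negP; move: aN.
have n4 : (4%:R : C) != 0 by rewrite pnatr_eq0.
rewrite !inE => /or3P[] /eqP ->.
- by rewrite !expr0n mulr0 subr0 sub0r oppr_eq0 oner_neq0.
- by rewrite !expr1n mulr1 addrAC subrr sub0r oppr_eq0 mulf_neq0 ?neq0Ci.
- by rewrite -[4%N]/(2 * 2)%N exprM sqrrN !expr1n mulr1 addrAC subrr sub0r oppr_eq0
  mulf_neq0 ?neq0Ci.
Qed.

(** At the parameter [xi0] the point of the plane is also one where xX + yY
    vanishes, so the restriction there is a value of a binary form invariant
    under the binary tetrahedral group; there is no such form in these degrees. *)
Lemma on_plane_xi0 d r : r \is d.-homog -> invariants r -> (d = 2 \/ d = 10)%N ->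
  root (on_plane r) xi0.
Proof.
move=> hr rinv hd; rewrite rootE horner_pull_line on_plane_point.
have <- : pt xi0 1 xi0 (- xi0 * xi0) = pt xi0 1 xi0 i_.
  by apply: eq_pt => //; rewrite mulNr -expr2 xi0_sqr opprK.
by rewrite -on_null_point -horner_pull_line -/(on_null r) (on_null_eq0 hr rinv hd) horner0.
Qed.

(** The element a^2 = -1 acts on W by -1. *)
Lemma on_plane_odd d r : r \is d.-homog -> invariants r -> odd d -> on_plane r = 0.
Proof.
move=> hr rinv od; apply: poly_eq0_horner => a; rewrite horner_pull_line.
apply: (@eigenvector_vanish _ d (matA R *m matA R) _ _ (-1) hr).
- by apply: rinv; apply: G5_mul; exact: G5_a.
- have [x [y [X [Y ->]]]] := pt_surj (pt 0 1 0 i_ + a *: pt 1 0 1 0).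
  have i2 := iC2 R.
  rewrite mx2M (_ : mx2 _ _ _ _ = mx2 (-1) 0 0 (-1)); last by apply: eq_mx2; ring : i2.
  have d1 : (-1) * (-1) - 0 * 0 = 1 :> C by ring.
  by rewrite actW_pt d1 ?oner_neq0 // !divr1 ptZ; apply: eq_pt; ring.
- by rewrite -signr_odd od expr1 -subr_eq0 -opprD oppr_eq0 -mulr2n pnatr_eq0.
Qed.

End Plane.

(** * Semi-invariants of bidegrees (4, 0), (3, 1) and (2, 2) *)

Lemma mpolyCX n (K : comNzRingType) (c : K) k :
  (c ^+ k)%:MP_[n] = c%:MP_[n] ^+ k.
Proof. exact: rmorphXn. Qed.

Section SemiInvariants.
Variable R : realType.
Local Notation C := R[i].
Local Notation CW := {mpoly C[4]}.
Local Notation i_ := ('i : C).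
Local Notation k_ := (kappa R).
Local Notation s_ := (sigma R).
Local Notation x_ := (coord_x R). Local Notation y_ := (coord_y R).
Local Notation X_ := (coord_X R). Local Notation Y_ := (coord_Y R).
Implicit Type a : C.

Definition pairing : CW := x_ * X_ + y_ * Y_.
Definition sextic_V : CW := sextic x_ y_.
Definition Phi0 a : CW := quartic0 a%:MP x_ y_.
Definition Phi1 a : CW := quartic1 a%:MP x_ y_ X_ Y_.
Definition Phi2 a : CW := quartic2 a%:MP x_ y_ X_ Y_.

Definition inv_2kappa : C := (2%:R * k_)^-1.

Lemma act_matC (f := act_poly (matC R)) (k : CW := k_%:MP) (h : CW := inv_2kappa%:MP)
    (j : CW := i_%:MP) :
  [/\ f x_ = k * (x_ - y_), f y_ = k * j * (x_ + y_), f X_ = h * (X_ - Y_)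
    & f Y_ = - j * h * (X_ + Y_)].
Proof.
have k0 := kappa_neq0 R; have i2 := iC2 R; have i0 := neq0Ci C.
have n2 : (2%:R : C) != 0 by rewrite pnatr_eq0.
have e1 : (1 : C) ^+ 2 = 1 by rewrite expr1n.
have d0 := det_refl_mx_neq0 e1 k0; have [fx fy fX fY] := act_poly_coord d0.
rewrite /f matC_refl_mx /refl_mx fx fy fX fY (det_refl_mx _ e1).
have -> : i_ * k_ / (2%:R * i_ * k_ ^+ 2) = inv_2kappa by rewrite /inv_2kappa; field;
  rewrite i0 k0.
have -> : - (1 * i_ * k_) / (2%:R * i_ * k_ ^+ 2) = - inv_2kappa by rewrite
  /inv_2kappa; field; rewrite i0 k0.
have iV : i_^-1 = - i_ by rewrite invCi.
have -> : - - (1 * k_) / (2%:R * i_ * k_ ^+ 2) = - (i_ * inv_2kappa).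
  by transitivity (i_^-1 * inv_2kappa); [rewrite /inv_2kappa; field;
    rewrite i0 k0|rewrite iV mulNr].
have -> : k_ / (2%:R * i_ * k_ ^+ 2) = - (i_ * inv_2kappa).
  by transitivity (i_^-1 * inv_2kappa); [rewrite /inv_2kappa; field;
    rewrite i0 k0|rewrite iV mulNr].
by rewrite !mul1r !mpolyCN !(mpolyCM _ i_); split; rewrite -/k -/h -/j; ring.
Qed.

Lemma act_matA (f := act_poly (matA R)) (j : CW := i_%:MP) :
  [/\ f x_ = j * x_, f y_ = - j * y_, f X_ = - j * X_ & f Y_ = j * Y_].
Proof.
have d1 : i_ * (- i_) - 0 * 0 = 1 by rewrite mul0r subr0 mulrN -expr2 iC2 opprK.
have d0 : i_ * (- i_) - 0 * 0 != 0 by rewrite d1 oner_neq0.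
have [fx fy fX fY] := act_poly_coord d0.
rewrite /f /matA fx fy fX fY d1 !divr1 oppr0 mpolyC0 !mpolyCN -/j.
by split; ring.
Qed.

Lemma act_matB (f := act_poly (matB R)) :
  [/\ f x_ = y_, f y_ = - x_, f X_ = Y_ & f Y_ = - X_].
Proof.
have d1 : 0 * 0 - 1 * (-1) = 1 :> C by rewrite mul0r mul1r sub0r opprK.
have d0 : 0 * 0 - 1 * (-1) != 0 :> C by rewrite d1 oner_neq0.
have [fx fy fX fY] := act_poly_coord d0.
rewrite /f /matB fx fy fX fY d1 !divr1 opprK mpolyC0 !mpolyCN mpolyC1.
by split; ring.
Qed.

Lemma act_matD (f := act_poly (matD R)) (s : CW := s_%:MP) :
  [/\ f x_ = s * x_, f y_ = s * y_, f X_ = s ^+ 2 * X_ & f Y_ = s ^+ 2 * Y_].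
Proof.
have s0 := sigma_neq0 R.
have d0 : s_ * s_ - 0 * 0 != 0 by rewrite mul0r subr0 mulf_neq0.
have [fx fy fX fY] := act_poly_coord d0.
have sE : s_ / (s_ * s_ - 0 * 0) = s_ ^+ 2.
  rewrite mul0r subr0 invfM mulrA mulfV // mul1r.
  by apply: (mulfI s0); rewrite mulfV // -exprS sigma3.
rewrite /f /matD fx fy fX fY sE oppr0 !mul0r ?mpolyC0 !mpolyCX -/s.
by split; ring.
Qed.

Lemma mpolyC_sqr a : a ^+ 2 = - 3%:R -> (a%:MP : CW) ^+ 2 = - 3%:R.
Proof. by move=> a2; rewrite -mpolyCX a2 mpolyCN; congr (- _); exact: rmorph_nat. Qed.

Lemma mpolyC_i_sqr : (i_%:MP : CW) ^+ 2 = -1.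
Proof. by rewrite -mpolyCX iC2 mpolyCN mpolyC1. Qed.

Lemma mpolyC_sigma3 : (s_%:MP : CW) ^+ 3 = 1.
Proof. by rewrite -mpolyCX sigma3 mpolyC1. Qed.

Lemma act_Phi0 g a :
  act_poly g (Phi0 a) = quartic0 a%:MP (act_poly g x_) (act_poly g y_).
Proof. exact: comp_quartic0. Qed.

Lemma act_Phi1 g a : act_poly g (Phi1 a) = quartic1 a%:MP
  (act_poly g x_) (act_poly g y_) (act_poly g X_) (act_poly g Y_).
Proof. exact: comp_quartic1. Qed.

Lemma act_Phi2 g a : act_poly g (Phi2 a) = quartic2 a%:MP
  (act_poly g x_) (act_poly g y_) (act_poly g X_) (act_poly g Y_).
Proof. exact: comp_quartic2. Qed.

Lemma act_sextic_V g : act_poly g sextic_V = sextic (act_poly g x_) (act_poly g y_).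
Proof. exact: comp_sextic. Qed.

Lemma act_pairing g :
  act_poly g pairing = act_poly g x_ * act_poly g X_ + act_poly g y_ * act_poly g Y_.
Proof. by rewrite /pairing (rmorphD (act_poly g)) /= !(rmorphM (act_poly g)). Qed.

Lemma act_mul g (f1 f2 : CW) : act_poly g (f1 * f2) = act_poly g f1 * act_poly g f2.
Proof. exact: (rmorphM (act_poly g)). Qed.

Lemma coord_homog : [/\ x_ \is 1.-homog, y_ \is 1.-homog,
  X_ \is 1.-homog & Y_ \is 1.-homog].
Proof. by split; rewrite dhomogX /= mdeg1. Qed.

Lemma Phi0_homog a : Phi0 a \is 4.-homog.
Proof. have [hx hy hX hY] := coord_homog; exact: dhomog_quartic0. Qed.

Lemma Phi1_homog a : Phi1 a \is 4.-homog.
Proof. have [hx hy hX hY] := coord_homog; exact: dhomog_quartic1. Qed.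

Lemma Phi2_homog a : Phi2 a \is 4.-homog.
Proof. have [hx hy hX hY] := coord_homog; exact: dhomog_quartic2. Qed.

Lemma conj_i_sqrt3 : (i_sqrt3 R)^* = - i_sqrt3 R.
Proof.
rewrite /i_sqrt3 rmorphM /= conjCi mulNr; congr (- (_ * _)).
by apply: conj_Creal; apply: sqrtC_real; rewrite ler0n.
Qed.

Lemma G22E : G22 R = Phi2 (i_sqrt3 R).
Proof.
have n4 : (4%:R : C)%:MP_[4] = 4%:R :> CW by exact: rmorph_nat.
by rewrite /G22 /Phi2 /quartic2 -!mul_mpolyC n4 -/(i_sqrt3 R); ring.
Qed.

Lemma conj_G22 : map_mpoly Num.conj (G22 R) = Phi2 (- i_sqrt3 R).
Proof.
have e := @map_quartic2 4 C C Num.conj (i_sqrt3 R) x_ y_ X_ Y_.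
rewrite G22E -conj_i_sqrt3 [LHS]e.
do 4! rewrite (map_mpolyX Num.conj).
by [].
Qed.

Lemma R44E : R44 R = Phi2 (i_sqrt3 R) * Phi2 (- i_sqrt3 R).
Proof. by rewrite /R44 conj_G22 G22E. Qed.

Lemma R44_homog : R44 R \is 8.-homog.
Proof. rewrite R44E; exact: (dhomogM (Phi2_homog _) (Phi2_homog _)). Qed.

(** The eigenvalues of c on [Phi0 a], [Phi1 a] and [Phi2 a]. *)
Definition mult0 a : C := 2%:R * k_ ^+ 4 * (1 + a).
Definition mult1 a : C := - (2%:R * i_ * k_ ^+ 3 * inv_2kappa * (1 + a)).
Definition mult2 a : C := - (2%:R * k_ ^+ 2 * inv_2kappa ^+ 2 * (1 + a)).

(** The conjugate parameter is a variable b, here and below, because the two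
    relations are used with a and b exchanged. *)
Lemma Phi_hessian a b : a ^+ 2 = - 3%:R -> b = - a ->
  Phi0 a * Phi2 a = Phi1 a ^+ 2 - pairing ^+ 2 * Phi0 b.
Proof.
by move=> a2 ->; rewrite /Phi0 mpolyCN; exact: quartic_hessian (mpolyC_sqr a2).
Qed.

Lemma Phi_cubes a b : a ^+ 2 = - 3%:R -> b = - a ->
  Phi0 a ^+ 3 + Phi0 b ^+ 3 = - 108%:R * sextic_V ^+ 2.
Proof.
by move=> a2 ->; rewrite /Phi0 mpolyCN; exact: quartic_cubes (mpolyC_sqr a2).
Qed.

Section Alpha.
Variable a : C.
Hypothesis a2 : a ^+ 2 = - 3%:R.

Lemma Phi_c (f := act_poly (matC R)) : [/\ f (Phi0 a) = (mult0 a)%:MP * Phi0 a,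
  f (Phi1 a) = (mult1 a)%:MP * Phi1 a & f (Phi2 a) = (mult2 a)%:MP * Phi2 a].
Proof.
have [fx fy fX fY] := act_matC; have h := mpolyC_sqr a2; have j2 := mpolyC_i_sqr.
split; rewrite /f.
- rewrite act_Phi0 fx fy /mult0.
  rewrite [in RHS](rmorph_mult0 (@mpolyC 4 C)).
  exact: quartic0_reflection.
- rewrite act_Phi1 fx fy fX fY /mult1.
  rewrite [in RHS](rmorph_mult1 (@mpolyC 4 C)).
  exact: quartic1_reflection.
- rewrite act_Phi2 fx fy fX fY /mult2.
  rewrite [in RHS](rmorph_mult2 (@mpolyC 4 C)).
  exact: quartic2_reflection.
Qed.

End Alpha.
End SemiInvariants.

(** * Invariants of G_5 *)

Section Invariants.
Variable R : realType.
Local Notation C := R[i].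
Local Notation CW := {mpoly C[4]}.
Local Notation i_ := ('i : C).
Local Notation k_ := (kappa R).
Local Notation s_ := (sigma R).
Implicit Type a : C.

Lemma kappa6 : k_ ^+ 6 = i_ / 8%:R.
Proof.
have := sigma3 R; rewrite sigmaE exprMn -exprM => h.
have i2 := iC2 R.
have e : (2%:R * i_) ^+ 3 * (i_ / 8%:R) = 1.
  by field : i2.
apply: (@mulfI _ ((2%:R * i_) ^+ 3)).
  by rewrite expf_neq0 // mulf_neq0 ?neq0Ci // pnatr_eq0.
by rewrite h e.
Qed.

Lemma inv_2kappaK : inv_2kappa R * k_ = 2%:R^-1.
Proof. by rewrite /inv_2kappa invfM mulfVK // kappa_neq0. Qed.

Lemma mult2E a : mult2 a = - (1 + a) / 2%:R.
Proof.
rewrite /mult2 (_ : 2%:R * k_ ^+ 2 * inv_2kappa R ^+ 2 = 2%:R * (inv_2kappa R * k_) ^+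
  2); last by ring.
by rewrite inv_2kappaK; field.
Qed.

Lemma mult01E a : mult0 a * mult1 a = - (2%:R * i_ * k_ ^+ 6 * (1 + a) ^+ 2).
Proof.
rewrite /mult0 /mult1.
rewrite (_ : _ * _ = - (4%:R * i_ * k_ ^+ 6 * (inv_2kappa R * k_) * (1 + a) ^+ 2));
  last by ring.
by rewrite inv_2kappaK; field.
Qed.

Lemma mult2_cube a : a ^+ 2 = - 3%:R -> mult2 a ^+ 3 = 1.
Proof. by move=> a2; rewrite mult2E; field : a2. Qed.

Lemma mult2_neq1 a : a ^+ 2 = - 3%:R -> mult2 a != 1.
Proof.
move=> a2; apply/eqP; rewrite mult2E => e.
have aE : a = - 3%:R.
  have : - (1 + a) / 2%:R * 2%:R = 2%:R by rewrite e mul1r.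
  rewrite divfK ?pnatr_eq0 // => e'.
  by transitivity (- 1 - (- (1 + a))); [ring|rewrite e'; ring].
by move/eqP: a2; rewrite aE -subr_eq0 (_ : _ - _ = 12%:R) ?pnatr_eq0 //; ring.
Qed.

Section Alpha.
Variables a b : C.
Hypotheses (a2 : a ^+ 2 = - 3%:R) (ab : b = - a).

Lemma mult012 : mult0 a * mult1 a * mult2 a = 1.
Proof.
have i2 := iC2 R.
by rewrite mult01E mult2E kappa6; field : a2 i2.
Qed.

Lemma mult0002 : mult0 a * mult0 b * (mult0 a * mult2 b) = 1.
Proof.
rewrite ab.
have i2 := iC2 R.
transitivity (- (4%:R * (k_ ^+ 6) ^+ 2 * (1 + a) ^+ 2 * (1 - a) ^+ 2)).
  by rewrite mult2E /mult0; field.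
by rewrite kappa6; field : a2 i2.
Qed.

End Alpha.

(** Fixed by a and b, with eigenvalue c under c and sigma ^+ d under d. *)
Definition semi_invariant (f : CW) (c : C) (d : nat) :=
  [/\ act_poly (matA R) f = f, act_poly (matB R) f = f,
      act_poly (matC R) f = c%:MP * f & act_poly (matD R) f = s_%:MP ^+ d * f].

Lemma semi_invariantM f g c c' d d' : semi_invariant f c d ->
  semi_invariant g c' d' -> semi_invariant (f * g) (c * c') (d + d').
Proof.
move=> [f1 f2 f3 f4] [g1 g2 g3 g4].
split.
- by rewrite act_mul f1 g1.
- by rewrite act_mul f2 g2.
- by rewrite act_mul f3 g3 mpolyCM mulrACA.
- by rewrite act_mul f4 g4 exprD mulrACA.
Qed.

Lemma semi_invariantP f c d : semi_invariant f c (3 * d) -> c = 1 -> invariants f.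
Proof.
move=> [f1 f2 f3 f4] c1; apply: invariants_gen.
- exact: f1.
- exact: f2.
- by rewrite f3 c1 mpolyC1 mul1r.
- by rewrite f4 exprM mpolyC_sigma3 expr1n mul1r.
Qed.

Lemma Phi0_semi a : a ^+ 2 = - 3%:R -> semi_invariant (Phi0 a) (mult0 a) 1.
Proof.
move=> a2; have j2 := mpolyC_i_sqr R; have s3 := mpolyC_sigma3 R; have [f _ _] := Phi_c a2.
split; [rewrite act_Phi0|rewrite act_Phi0|exact: f|rewrite act_Phi0].
- have [-> -> _ _] := act_matA R.
  by have [-> _ _] := quartic_diag a%:MP (coord_x R) (coord_y R) (coord_X R) (coord_Y R) j2.
- have [-> -> _ _] := act_matB R.
  by have [-> _ _] := quartic_swap a%:MP (coord_x R) (coord_y R) (coord_X R) (coord_Y R).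
- have [-> -> _ _] := act_matD R.
  by have [-> _ _] := quartic_scalar a%:MP (coord_x R) (coord_y R) (coord_X R) (coord_Y R) s3;
    rewrite ?expr0 ?expr1 ?mul1r.
Qed.

Lemma Phi1_semi a : a ^+ 2 = - 3%:R -> semi_invariant (Phi1 a) (mult1 a) 2.
Proof.
move=> a2; have j2 := mpolyC_i_sqr R; have s3 := mpolyC_sigma3 R; have [_ f _] := Phi_c a2.
split; [rewrite act_Phi1|rewrite act_Phi1|exact: f|rewrite act_Phi1].
- have [-> -> -> ->] := act_matA R.
  by have [_ -> _] := quartic_diag a%:MP (coord_x R) (coord_y R) (coord_X R) (coord_Y R) j2.
- have [-> -> -> ->] := act_matB R.
  by have [_ -> _] := quartic_swap a%:MP (coord_x R) (coord_y R) (coord_X R) (coord_Y R).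
- have [-> -> -> ->] := act_matD R.
  by have [_ -> _] := quartic_scalar a%:MP (coord_x R) (coord_y R) (coord_X R) (coord_Y R) s3;
    rewrite ?expr0 ?expr1 ?mul1r.
Qed.

Lemma Phi2_semi a : a ^+ 2 = - 3%:R -> semi_invariant (Phi2 a) (mult2 a) 0.
Proof.
move=> a2; have j2 := mpolyC_i_sqr R; have s3 := mpolyC_sigma3 R; have [_ _ f] := Phi_c a2.
split; [rewrite act_Phi2|rewrite act_Phi2|exact: f|rewrite act_Phi2].
- have [-> -> -> ->] := act_matA R.
  by have [_ _ ->] := quartic_diag a%:MP (coord_x R) (coord_y R) (coord_X R) (coord_Y R) j2.
- have [-> -> -> ->] := act_matB R.
  by have [_ _ ->] := quartic_swap a%:MP (coord_x R) (coord_y R) (coord_X R) (coord_Y R).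
- have [-> -> -> ->] := act_matD R.
  by have [_ _ ->] := quartic_scalar a%:MP (coord_x R) (coord_y R) (coord_X R) (coord_Y R) s3;
    rewrite ?expr0 ?expr1 ?mul1r.
Qed.

Lemma invariants_cube a : a ^+ 2 = - 3%:R -> invariants (Phi2 a * (Phi2 a * Phi2 a)).
Proof.
move=> a2; have h := Phi2_semi a2.
apply: (@semi_invariantP _ _ 0 (semi_invariantM h (semi_invariantM h h))).
by rewrite -(mult2_cube a2); ring.
Qed.

Lemma invariants_012 a : a ^+ 2 = - 3%:R -> invariants (Phi2 a * (Phi0 a * Phi1 a)).
Proof.
move=> a2; apply: (@semi_invariantP _ _ 1
  (semi_invariantM (Phi2_semi a2) (semi_invariantM (Phi0_semi a2) (Phi1_semi a2)))).
by rewrite -(mult012 a2); ring.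
Qed.

Lemma invariants_0002 a b : a ^+ 2 = - 3%:R -> b ^+ 2 = - 3%:R -> b = - a ->
  invariants (Phi2 b * (Phi0 a * (Phi0 a * Phi0 b))).
Proof.
move=> a2 b2 ab; apply: (@semi_invariantP _ _ 1 (semi_invariantM (Phi2_semi b2)
  (semi_invariantM (Phi0_semi a2) (semi_invariantM (Phi0_semi a2) (Phi0_semi b2))))).
by rewrite -(mult0002 a2 ab); ring.
Qed.

Lemma invariants_pairing : invariants (pairing R).
Proof.
have j2 := mpolyC_i_sqr R; have s3 := mpolyC_sigma3 R.
have hkM : 2%:R * ((inv_2kappa R)%:MP * k_%:MP) = 1 :> CW.
  rewrite -mpolyCM inv_2kappaK -[2%:R](rmorph_nat (@mpolyC 4 C)) -mpolyCM mulfV ?pnatr_eq0 //.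
apply: invariants_gen; rewrite act_pairing /pairing.
- by have [-> -> -> ->] := act_matA R; ring : j2.
- by have [-> -> -> ->] := act_matB R; ring.
- have [-> -> -> ->] := act_matC R; rewrite -[RHS]mul1r -hkM.
  by ring : j2.
- by have [-> -> -> ->] := act_matD R; ring : s3.
Qed.

Lemma invariants_sextic_V : invariants (sextic_V R).
Proof.
have j2 := mpolyC_i_sqr R; have s3 := mpolyC_sigma3 R.
have k6 : 8%:R * i_%:MP * k_%:MP ^+ 6 = - 1 :> CW.
  rewrite -mpolyCX kappa6 -[8%:R](rmorph_nat (@mpolyC 4 C)) -!mpolyCM -mpolyC1 -mpolyCN.
  by congr (_%:MP); have i2 := iC2 R; field : i2.
apply: invariants_gen; rewrite act_sextic_V.
- by have [-> -> _ _] := act_matA R; exact: sextic_diag.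
- by have [-> -> _ _] := act_matB R; exact: sextic_swap.
- by have [-> -> _ _] := act_matC R; exact: sextic_reflection.
- by have [-> -> _ _] := act_matD R; exact: sextic_scalar.
Qed.

End Invariants.

(** * Points with non-trivial stabiliser *)

Section Stabilisers.
Variable R : realType.
Local Notation C := R[i].
Local Notation CW := {mpoly C[4]}.
Local Notation i_ := ('i : C).
Local Notation k_ := (kappa R).
Implicit Types (a p q : C) (g n m : 'M[C]_2) (w : 'cV[C]_4).

(** For p of order dividing 12, the matrices [mono_diag p] and [mono_anti p] are
    the products of a quaternion, generated by a and b, and of a power of d: a
    normal subgroup of order 24. The sign p ^+ 6 tells the quaternions 1, b from
    the quaternions a, ab. *)
Definition mono_diag p : 'M[C]_2 := mx2 p 0 0 (p ^+ 7).
Definition mono_anti p : 'M[C]_2 := mx2 0 p (- p ^+ 7) 0.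
Definition Q8mu3 n := exists2 p, p ^+ 12 = 1 & n = mono_diag p \/ n = mono_anti p.

Lemma Q8mu3_diag p (q r s t : C) : p ^+ 12 = 1 -> q = p -> r = 0 -> s = 0 ->
  t = p ^+ 7 -> Q8mu3 (mx2 q r s t).
Proof. by move=> p12 -> -> -> ->; exists p => //; left. Qed.

Lemma Q8mu3_antidiag p (q r s t : C) : p ^+ 12 = 1 -> q = 0 -> r = p ->
  s = - p ^+ 7 -> t = 0 -> Q8mu3 (mx2 q r s t).
Proof. by move=> p12 -> -> -> ->; exists p => //; right. Qed.

Lemma Q8mu3M n m : Q8mu3 n -> Q8mu3 m -> Q8mu3 (n *m m).
Proof.
move=> [p p12 nE] [q q12 mE].
case: nE => ->; case: mE => ->; rewrite /mono_diag /mono_anti mx2M.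
- by apply: (@Q8mu3_diag (p * q)); ring : p12 q12.
- by apply: (@Q8mu3_antidiag (p * q)); ring : p12 q12.
- by apply: (@Q8mu3_antidiag (p * q ^+ 7)); ring : p12 q12.
- by apply: (@Q8mu3_diag (- (p * q ^+ 7))); ring : p12 q12.
Qed.

Lemma Q8mu3V n : Q8mu3 n -> exists2 m, Q8mu3 m & n *m m = 1%:M.
Proof.
move=> [p p12 [->|->]].
  exists (mono_diag (p ^+ 11)); first by exists (p ^+ 11); [ring : p12|left].
  by rewrite /mono_diag mx2M -mx2_1; apply: eq_mx2; ring : p12.
exists (mono_anti (- p ^+ 5)); first by exists (- p ^+ 5); [ring : p12|right].
by rewrite /mono_anti mx2M -mx2_1; apply: eq_mx2; ring : p12.
Qed.

Lemma matC_Q8mu3 n : Q8mu3 n -> exists2 m, Q8mu3 m & matC R *m n = m *m matC R.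
Proof.
move=> [p p12]; have i2 := iC2 R.
have ip12 : (- (i_ * p)) ^+ 12 = 1 by ring : p12 i2.
have mp12 : (- p) ^+ 12 = 1 by ring : p12.
have : (p ^+ 6) ^+ 2 = 1 by rewrite -exprM.
move/eqP; rewrite sqrf_eq1 matC_refl_mx /refl_mx => /orP[] /eqP p6 [] ->.
- exists (mono_diag p); first by exists p => //; left.
  by rewrite !mx2M; apply: eq_mx2; ring : p6.
- exists (mono_anti (- (i_ * p))); first by exists (- (i_ * p)) => //; right.
  by rewrite !mx2M; apply: eq_mx2; ring : p6 i2.
- exists (mono_anti (- (i_ * p))); first by exists (- (i_ * p)) => //; right.
  by rewrite !mx2M; apply: eq_mx2; ring : p6 i2.
- exists (mono_diag (- p)); first by exists (- p) => //; left.
  by rewrite !mx2M; apply: eq_mx2; ring : p6 i2.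
Qed.

Definition cpow e : 'M[C]_2 := iter e (mulmx (matC R)) 1%:M.

Lemma cpowD e d : cpow (e + d) = cpow e *m cpow d.
Proof. by elim: e => [|e IH]; rewrite ?mul1mx // /= IH mulmxA. Qed.

Lemma cpow3 e : cpow (3 * e) = 1%:M.
Proof.
elim: e => // e IH; rewrite mulnS cpowD IH mulmx1 /= mulmx1 matC_refl_mx mulmxA.
by apply: refl_mx_cube; [exact: refl_scalar_kappa|exact: expr1n].
Qed.

Lemma cpow_Q8mu3 e n : Q8mu3 n -> exists2 m, Q8mu3 m & cpow e *m n = m *m cpow e.
Proof.
elim: e n => [|e IH] n nN; first by exists n; rewrite // mul1mx mulmx1.
have [m mN mE] := IH n nN; have [l lN lE] := matC_Q8mu3 mN; exists l => //.
by rewrite /= -mulmxA mE !mulmxA lE.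
Qed.

(** The quotient of G_5 by the normal subgroup [Q8mu3] is generated by the image
    of c. *)
Lemma G5_Q8mu3_cpow g : G5 g -> exists n e, Q8mu3 n /\ g = n *m cpow e.
Proof.
have N1 : Q8mu3 1%:M.
  by exists 1; [rewrite expr1n|left; rewrite /mono_diag expr1n mx2_1].
have i2 := iC2 R.
elim=> {g} [||||||g gG [n [e [nN gE]]]].
- exists (matA R), 0%N; split; last by rewrite mulmx1.
  by exists i_; [ring : i2|left; apply: eq_mx2 => //; ring : i2].
- exists (matB R), 0%N; split; last by rewrite mulmx1.
  by exists 1; [rewrite expr1n|right; apply: eq_mx2 => //; rewrite expr1n].
- by exists 1%:M, 1%N; rewrite mul1mx /= mulmx1.
- exists (matD R), 0%N; split; last by rewrite mulmx1.
  have s3 := sigma3 R.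
  by exists (sigma R); [ring : s3|left; apply: eq_mx2 => //; ring : s3].
- by exists 1%:M, 0%N; rewrite mul1mx.
- move=> g h _ [n [e [nN ->]]] _ [m [d [mN ->]]].
  have [l lN lE] := cpow_Q8mu3 e mN; exists (n *m l), (e + d)%N.
  split; first exact: Q8mu3M.
  by rewrite cpowD !mulmxA -(mulmxA n) lE !mulmxA.
(* the inverse of c^e is c^(2 e), as c^3 = 1 *)
have [m mN nm] := Q8mu3V nN; have [l lN lE] := cpow_Q8mu3 (2 * e) mN.
exists l, (2 * e)%N; split=> //; rewrite -lE.
have gu := G5_unit gG; apply: (can_inj (mulKmx gu)); rewrite mulmxV //.
rewrite gE mulmxA -(mulmxA n) -cpowD -{1}[e]mul1n -mulnDl cpow3 mulmx1.
exact/esym.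
Qed.

Lemma actW_mono_diag p x y X Y : p ^+ 12 = 1 -> actW (mono_diag p) *m pt x y X Y =
  pt (p * x) (p ^+ 7 * y) (p ^+ 11 * X) (p ^+ 5 * Y).
Proof.
move=> p12; have p0 : p != 0.
  by apply: contra_eq_neq p12 => ->; rewrite expr0n eq_sym oner_neq0.
have d0 : p * p ^+ 7 - 0 * 0 != 0 by rewrite mul0r subr0 mulf_neq0 ?expf_neq0.
rewrite /mono_diag actW_pt //; apply: eq_pt; try ring;
  by apply: (mulIf d0); rewrite divfK //; ring : p12.
Qed.

Lemma actW_mono_anti p x y X Y : p ^+ 12 = 1 -> actW (mono_anti p) *m pt x y X Y =
  pt (p * y) (- p ^+ 7 * x) (p ^+ 11 * Y) (- p ^+ 5 * X).
Proof.
move=> p12; have p0 : p != 0.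
  by apply: contra_eq_neq p12 => ->; rewrite expr0n eq_sym oner_neq0.
have d0 : 0 * 0 - p * - p ^+ 7 != 0.
  by rewrite mul0r sub0r mulrN opprK mulf_neq0 ?expf_neq0.
rewrite /mono_anti actW_pt //; apply: eq_pt; try ring;
  by apply: (mulIf d0); rewrite divfK //; ring : p12.
Qed.

Lemma coords_pt (x y X Y : C) : [/\ coords (pt x y X Y) (inord 0) = x, coords (pt x y X
  Y) (inord 1) = y,
  coords (pt x y X Y) (inord 2) = X & coords (pt x y X Y) (inord 3) = Y].
Proof. by split; rewrite /coords mxE inordK. Qed.

Lemma meval_Phi2 a x y X Y :
  (Phi2 a).@[coords (pt x y X Y)] = quartic2 a x y X Y.
Proof.
have [ex ey eX eY] := coords_pt x y X Y.
by rewrite [LHS]meval_quartic2 !mevalXU ex ey eX eY.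
Qed.

Lemma Phi2_Q8mu3 a n w : Q8mu3 n -> (Phi2 a).@[coords (actW n *m w)] = (Phi2 a).@[coords w].
Proof.
have [x [y [X [Y ->]]]] := pt_surj w => -[p p12 [->|->]].
  by rewrite actW_mono_diag // !meval_Phi2 (quartic2_monomial _ _ _ _ _ p12).1.
by rewrite actW_mono_anti // !meval_Phi2 (quartic2_monomial _ _ _ _ _ p12).2.
Qed.

Lemma Q8mu3_unit n : Q8mu3 n -> n \in unitmx.
Proof. by move=> /Q8mu3V[m _ /mulmx1_unit[]]. Qed.

Lemma cpow_unit e : cpow e \in unitmx.
Proof.
elim: e => [|e IH]; first exact: unitmx1.
by rewrite /= unitmx_mul (G5_unit (G5_c R)).
Qed.

Lemma Phi2_cpow a e w : a ^+ 2 = - 3%:R ->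
  (Phi2 a).@[coords (actW (cpow e) *m w)] = mult2 a ^+ e * (Phi2 a).@[coords w].
Proof.
move=> a2; elim: e => [|e IH]; first by rewrite actW1 mul1mx mul1r.
rewrite /= actWM ?cpow_unit ?(G5_unit (G5_c R)) // -mulmxA.
have [_ _ cE] := Phi_c a2.
by rewrite -meval_act_poly cE mevalM mevalC IH exprS mulrA.
Qed.

(** The entries of a diagonal element on W are powers of p with exponents prime
    to 12. The square of an antidiagonal one is the scalar - p ^+ 8 on V and
    - p ^+ 16 on V^*, both different from 1. *)
Lemma Q8mu3_fixed n w : Q8mu3 n -> n <> 1%:M -> actW n *m w = w -> w = 0.
Proof.
have [x [y [X [Y ->]]]] := pt_surj w => -[p p12 nE] n1.
have fix0 (c v : C) : c != 1 -> c * v = v -> v = 0.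
  move=> c1 /eqP; rewrite -subr_eq0 -{2}[v]mul1r -mulrBl mulf_eq0 subr_eq0.
  by rewrite (negPf c1) => /eqP.
have z0 : pt 0 0 0 0 = 0 :> 'cV[C]_4.
  by rewrite -[RHS](scale0r (pt 0 0 0 0)) ptZ mul0r.
have ptI (x1 y1 X1 Y1 x2 y2 X2 Y2 : C) : pt x1 y1 X1 Y1 = pt x2 y2 X2 Y2 ->
    [/\ x1 = x2, y1 = y2, X1 = X2 & Y1 = Y2].
  move=> e; have E k : coords (pt x1 y1 X1 Y1) k = coords (pt x2 y2 X2 Y2) k by rewrite e.
  have [a1 a2 a3 a4] := coords_pt x1 y1 X1 Y1; have [b1 b2 b3 b4] := coords_pt x2 y2 X2 Y2.
  by split; [rewrite -a1 E|rewrite -a2 E|rewrite -a3 E|rewrite -a4 E].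
case: nE => nE; rewrite nE.
  have p1 : p != 1.
    by apply: contra_not_neq n1 => e; rewrite nE /mono_diag e expr1n mx2_1.
  (* 7, 11 and 5 are their own inverses modulo 12 *)
  have pk k l : p ^+ (k * l) = p -> p ^+ k != 1.
    by move=> e; apply: contra p1 => /eqP pk; rewrite -e exprM pk expr1n.
  rewrite actW_mono_diag // => /ptI[ex ey eX eY]; rewrite -z0; apply: eq_pt.
  - exact: fix0 ex.
  - by apply: (fix0 _ _ _ ey); apply: (@pk 7 7); ring : p12.
  - by apply: (fix0 _ _ _ eX); apply: (@pk 11 11); ring : p12.
  - by apply: (fix0 _ _ _ eY); apply: (@pk 5 5); ring : p12.
rewrite actW_mono_anti // => /ptI[ex ey eX eY].
have n2 : (1 : C) != - 1 by rewrite -subr_eq0 opprK -mulr2n pnatr_eq0.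
have p8 : - p ^+ 8 != 1.
  rewrite eqr_oppLR; apply: contra n2 => /eqP e; apply/eqP.
  by transitivity ((p ^+ 8) ^+ 3); [ring : p12|rewrite e; ring].
have p16 : - p ^+ 16 != 1.
  rewrite eqr_oppLR; apply: contra n2 => /eqP e; apply/eqP.
  by transitivity ((p ^+ 16) ^+ 3); [ring : p12|rewrite e; ring].
have x0 : x = 0 by apply: (fix0 _ _ p8); rewrite -[RHS]ex -ey; ring.
have X0 : X = 0 by apply: (fix0 _ _ p16); rewrite -[RHS]eX -eY; ring.
by rewrite -z0; apply: eq_pt => //; rewrite -?ey -?eY ?x0 ?X0 mulr0.
Qed.

(** An element outside [Q8mu3] multiplies [Phi2 a] by a non-trivial cube root of
    unity; one inside it, other than 1, fixes only the origin. *)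
Lemma Phi2_stabiliser a w : a ^+ 2 = - 3%:R -> nontrivial_stabiliser w ->
  (Phi2 a).@[coords w] = 0.
Proof.
move=> a2 [g [gG g1 gw]]; have [n [e [nN gE]]] := G5_Q8mu3_cpow gG.
have m3 := mult2_cube a2.
have : (Phi2 a).@[coords w] = mult2 a ^+ e * (Phi2 a).@[coords w].
  have wE : actW n *m (actW (cpow e) *m w) = w.
    by rewrite mulmxA -(actWM (Q8mu3_unit nN) (cpow_unit e)) -gE.
  by rewrite -[in LHS]wE Phi2_Q8mu3 // Phi2_cpow.
have [me|me] := eqVneq (mult2 a ^+ e) 1; last first.
  move/eqP; rewrite -subr_eq0 -{1}[_.@[_]]mul1r -mulrBl mulf_eq0 subr_eq0.
  by rewrite eq_sym (negPf me) => /eqP.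
move=> _; have e3 : (e = 3 * (e %/ 3))%N.
  rewrite {1}(divn_eq e 3) mulnC -[RHS]addn0; congr (_ + _)%N.
  have : mult2 a ^+ (e %% 3) = 1.
    by rewrite -me {2}(divn_eq e 3) exprD mulnC exprM m3 expr1n mul1r.
  have := mult2_neq1 a2; have := ltn_pmod e (isT : 0 < 3)%N.
  case: (e %% 3)%N => [|[|[|]]] // _ m1; first by rewrite expr1 => m1'; rewrite m1' eqxx in m1.
  by move=> m2; move: m1; rewrite -m3 exprSr m2 mul1r eqxx.
have w0 : w = 0.
  have gn : g = n by rewrite gE e3 cpow3 mulmx1.
  by apply: (Q8mu3_fixed nN); rewrite -gn.
have [x [y [X [Y wE]]]] := pt_surj w.
have -> : w = pt 0 0 0 0.
  by rewrite w0 -[LHS](scale0r (pt 0 0 0 0)) ptZ mul0r.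
by rewrite meval_Phi2 /quartic2; ring.
Qed.

Lemma sing_ideal_Phi2 a f : a ^+ 2 = - 3%:R -> invariants (Phi2 a * f) ->
  sing_ideal (Phi2 a * f).
Proof.
move=> a2 finv; split=> // w ws.
by rewrite mevalM -/(coords w) (Phi2_stabiliser a2 ws) mul0r.
Qed.

End Stabilisers.

(** * An arc in W *)

Section Arc.
Variable R : realType.
Local Notation C := R[i].
Local Notation CW := {mpoly C[4]}.
Local Notation i_ := ('i : C).
Local Notation xi0 := (xi0 R).
Local Notation q_ := (qpoly R).
Implicit Types (f r : CW) (g : {poly C}).

(** The square makes eta - xi0 of order 2. *)
Definition eta : {poly C} := xi0%:P + 'X^2.

(** Restriction to the arc s (eta, 1, eta, i) in W, with s the variable. *)
Definition arc f : {poly C} :=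
  pull (fun i => 'X * (line (pt 0 1 0 i_) (pt 1 0 1 0) i \Po eta)) f.

HB.instance Definition _ := GRing.RMorphism.copy arc (pull _).

Lemma arc_homog d f : f \is d.-homog -> arc f = 'X^d * (on_plane f \Po eta).
Proof. by move=> hf; rewrite /arc (pull_scale _ _ hf) comp_pull. Qed.

Lemma arc_sum f :
  arc f = \sum_(d < msize f) 'X^d * (on_plane (pihomog mdeg d f) \Po eta).
Proof.
rewrite /arc pull_pihomog; apply: eq_bigr => d _.
exact: arc_homog (pihomogP _ _ _).
Qed.

Lemma arc_coord : [/\ arc (coord_x R) = 'X * eta, arc (coord_y R) = 'X,
  arc (coord_X R) = 'X * eta & arc (coord_Y R) = i_ *: 'X].
Proof.
rewrite /arc /coord_x /coord_y /coord_X /coord_Y !pullX /line !mxE !inordK //=.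
rewrite !scale1r !scale0r !add0r !addr0 comp_polyX !comp_polyC.
by split; rewrite ?mulr1 // mulrC mul_polyC.
Qed.

Definition qpoly_sqr_eta := (q_ ^+ 2) \Po eta.

Lemma horner_eta0 : eta.[0] = xi0.
Proof. by rewrite /eta !hornerE /= ?expr0n ?mul0r ?addr0. Qed.

Lemma qpoly_sqr_eta0 : qpoly_sqr_eta.[0] != 0.
Proof.
rewrite horner_comp horner_exp expf_neq0 // horner_eta0 horner_qpoly.
have -> : xi0 ^+ 4 - 4%:R * i_ * xi0 ^+ 2 - 1 = - 6%:R.
  have i2 := iC2 R; have x2 := xi0_sqr R; ring : x2 i2.
by rewrite oppr_eq0 pnatr_eq0.
Qed.

(** The result does not depend on a: its coefficient x^2 Y^2 + y^2 X^2 vanishes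
    on the plane. *)
Lemma arc_Phi2 a : arc (Phi2 a) = 'X^4 * (q_ \Po eta).
Proof.
have [ax ay aX aY] := arc_coord; have i2 := iC2 R.
have ii : i_%:P ^+ 2 = -1 by rewrite -polyC_exp i2 polyCN.
have -> : q_ \Po eta = eta ^+ 4 - (4%:R * i_) *: eta ^+ 2 - 1.
  by rewrite /qpoly !comp_polyB comp_polyZ !comp_Xn_poly -polyC1 comp_polyC.
rewrite [LHS](rmorph_quartic2 arc) /= ax ay aX aY /quartic2.
by rewrite -!mul_polyC polyCM polyC_natr; ring : ii.
Qed.

Lemma arc_R44 : arc (R44 R) = 'X^8 * qpoly_sqr_eta.
Proof.
have sqr (f g : CW) p : arc f = p -> arc g = p -> arc (f * g) = p * p.
  by move=> fp gp; transitivity (arc f * arc g); [exact: pullM|rewrite fp gp].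
rewrite R44E (sqr _ _ _ (arc_Phi2 _) (arc_Phi2 _)).
by rewrite /qpoly_sqr_eta expr2 comp_polyM mulrACA -exprD.
Qed.

End Arc.

(** * The chart along the arc *)

Lemma sub_frac_exp (F : fieldType) (f r N : F) n k : N != 0 ->
  f / N ^+ n - r / N ^+ k = (f * N ^+ k - r * N ^+ n) / N ^+ (n + k).
Proof. by move=> N0; rewrite exprD; field; rewrite !expf_neq0. Qed.

Section ChartArc.
Variable R : realType.
Local Notation C := R[i].
Local Notation CW := {mpoly C[4]}.
Local Notation K := {fraction CW}.
Local Notation "f %:F" := (tofrac f).
Local Notation xi0 := (xi0 R).
Local Notation q_ := (qpoly R).
Local Notation eta := (eta R).
Local Notation N_ := (arc (R44 R)).
Implicit Types (f r : CW) (g h : {poly C}) (u v : K).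

(** These polynomials form a subring, so that membership can be checked on the
    generators of the coordinate ring. *)
Definition const_mod4 g := exists c h, g = c%:P + 'X^4 * h.

Lemma const_mod4_subring g h : const_mod4 g -> const_mod4 h ->
  const_mod4 (g - h) /\ const_mod4 (g * h).
Proof.
move=> [a [p ->]] [b [q ->]]; split.
  by exists (a - b), (p - q); rewrite polyCB; ring.
exists (a * b), (a%:P * q + b%:P * p + 'X^4 * p * q); rewrite polyCM; ring.
Qed.

Lemma const_mod4D g h : const_mod4 g -> const_mod4 h -> const_mod4 (g + h).
Proof.
move=> [a [p ->]] [b [q ->]]; exists (a + b), (p + q); rewrite polyCD; ring.
Qed.

Lemma const_mod4C c : const_mod4 c%:P.
Proof. by exists c, 0; rewrite mulr0 addr0. Qed.

Lemma const_mod4X h : const_mod4 ('X^4 * h).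
Proof. by exists 0, h; rewrite add0r. Qed.

(** Here f restricts to P times the forms m d on the plane. In the sum of the
    s^d (P m_d)(eta), the degrees above k + 3 contribute order 4 beyond s^k, and
    the degree k + 2 does so too since m_(k+2)(eta) is divisible by
    eta - xi0 = s^2. *)
Lemma arc_expand k (P : {poly C}) f (m : nat -> {poly C}) :
  (forall d, on_plane (pihomog mdeg d f) = P * m d) ->
  (forall d, (d < k)%N -> m d = 0) -> (size (m k) <= 1)%N -> m k.+1 = 0 ->
  root (m k.+2) xi0 -> m k.+3 = 0 ->
  exists2 g, const_mod4 g & arc f = 'X^k * (P \Po eta) * g.
Proof.
move=> fE m_lt m_k m_k1 /factor_theorem[p m_k2] m_k3; rewrite arc_sum.
elim/big_ind: _ => [|_ _ [g gP ->] [h hP ->]|d _].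
- by exists 0; rewrite ?mulr0 // -[0]/(0%:P); exact: const_mod4C.
- by exists (g + h); [exact: const_mod4D|rewrite mulrDr].
rewrite fE comp_polyM; move: (nat_of_ord d) => {}d.
suff [g gP e] : exists2 g, const_mod4 g & 'X^d * (m d \Po eta) = 'X^k * g.
  by exists g => //; rewrite mulrCA e; ring.
have zero : m d = 0 -> exists2 g, const_mod4 g & 'X^d * (m d \Po eta) = 'X^k * g.
  by move=> ->; exists 0; rewrite ?comp_poly0 ?mulr0 // -[0]/(0%:P); exact: const_mod4C.
have [lt|/subnKC dE] := ltnP d k; first exact/zero/m_lt.
move: (d - k)%N dE zero => [|[|[|[|e]]]] <- zero.
- rewrite addn0 (size1_polyC m_k); exists (((m k)`_0)%:P); first exact: const_mod4C.
  by rewrite comp_polyC.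
- by apply: zero; rewrite addn1.
- rewrite addn2 m_k2 comp_polyM comp_polyB comp_polyX comp_polyC.
  exists ('X^4 * (p \Po eta)); first exact: const_mod4X.
  by rewrite /eta -addn2 exprD; ring.
- by apply: zero; rewrite addn3.
exists ('X^4 * ('X^e * (m (k + e.+4)%N \Po eta))); first exact: const_mod4X.
by rewrite -addn4 addnCA addnA !exprD; ring.
Qed.

Lemma arc_invariants f : invariants f -> const_mod4 (arc f).
Proof.
move=> finv; have hinv d := invariants_pihomog d finv.
have hhom d : pihomog mdeg d f \is d.-homog := pihomogP _ _ _.
have odd0 d : odd d -> on_plane (pihomog mdeg d f) = 0.
  by move=> od; apply: on_plane_odd (hhom d) (hinv d) od.
have [||||||g gP ->] := @arc_expand 0 1 f (fun d => on_plane (pihomog mdeg d f)).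
- by move=> d; rewrite mul1r.
- by [].
- exact: size_pull_line (hhom 0%N).
- exact: odd0.
- by apply: on_plane_xi0 (hhom 2%N) (hinv 2%N) _; left.
- exact: odd0.
by rewrite mul1r -polyC1 comp_polyC mul1r.
Qed.

(** Divided by R_{4,4}, the forms of degree 8 become constants on the plane, those
    of degree 10 still vanish at [xi0], and those of smaller degree are zero. *)
Lemma arc_sing_ideal r : sing_ideal r ->
  exists2 g, const_mod4 g & arc r = N_ * g.
Proof.
move=> rI; have hI d := sing_ideal_pihomog d rI; have hinv d := (hI d).1.
have hhom d : pihomog mdeg d r \is d.-homog := pihomogP _ _ _.
pose m d := on_plane (pihomog mdeg d r) %/ q_ ^+ 2.
have mE d : on_plane (pihomog mdeg d r) = q_ ^+ 2 * m d.
  by rewrite mulrC divpK //; apply: sing_ideal_on_plane (hhom d) (hI d).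
have odd0 d : odd d -> m d = 0.
  by move=> od; rewrite /m (on_plane_odd (hhom d) (hinv d) od) div0p.
have sm d : m d != 0 -> (size (m d) + 8 <= d.+1)%N.
  move=> m0; rewrite -size_qpoly_sqr // -mE; exact: size_pull_line (hhom d).
rewrite arc_R44; apply: (@arc_expand 8 (q_ ^+ 2) r m mE).
- move=> d d8; apply/eqP; apply: contraTT d8 => m0; rewrite -leqNgt.
  rewrite -ltnS (leq_trans _ (sm d m0)) // -[9%N]/(1 + 8)%N leq_add2r.
  by rewrite size_poly_gt0.
- have [->|/sm] := eqVneq (m 8%N) 0; first by rewrite size_poly0.
  by rewrite -[9%N]/(1 + 8)%N leq_add2r.
- exact: odd0.
- have : root (on_plane (pihomog mdeg 10 r)) xi0.
    by apply: on_plane_xi0 (hhom 10%N) (hinv 10%N) _; right.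
  rewrite mE rootM => /orP[|//]; have := qpoly_sqr_eta0 R.
  by rewrite /qpoly_sqr_eta horner_comp horner_eta0 rootE => /negPf ->.
- exact: odd0.
Qed.

(** The restriction of a fraction to the arc, as a relation because a fraction
    has many expressions. *)
Definition arc_rel u g := exists n f,
  u = f%:F / (R44 R)%:F ^+ n /\ arc f = N_ ^+ n * g.

Lemma N_neq0 : N_ != 0.
Proof.
rewrite arc_R44 mulf_neq0 ?expf_neq0 ?polyX_eq0 //.
by apply: contra_neq (qpoly_sqr_eta0 R) => ->; rewrite horner0.
Qed.

Lemma R44_neq0 : (R44 R)%:F != 0.
Proof.
by rewrite tofrac_eq0; apply: contra_neq N_neq0 => ->; rewrite rmorph0.
Qed.

(** R_{4,4} does not vanish identically on the arc. *)
Lemma arc_rel_inj u g h : arc_rel u g -> arc_rel u h -> g = h.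
Proof.
move=> [n [f [-> fg]]] [k [r [/eqP e rh]]]; move: e.
rewrite eqr_div ?expf_neq0 ?R44_neq0 // -!tofracXn -!tofracM tofrac_eq => /eqP e.
have := congr1 (@arc R) e; rewrite (rmorphM _ f) (rmorphM _ r) !rmorphXn /= fg rh => {}e.
apply: (mulfI (expf_neq0 (n + k) N_neq0)); rewrite exprD.
by rewrite mulrAC e; ring.
Qed.

Lemma arc_relB u v g h : arc_rel u g -> arc_rel v h -> arc_rel (u - v) (g - h).
Proof.
move=> [n [f [-> fg]]] [k [r [-> rh]]].
exists (n + k)%N, (f * R44 R ^+ k - r * R44 R ^+ n); split.
  by rewrite tofracB (tofracM f) (tofracM r) !tofracXn; apply: sub_frac_exp; exact: R44_neq0.
by rewrite rmorphB (rmorphM _ f) (rmorphM _ r) !rmorphXn /= fg rh exprD; ring.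
Qed.

Lemma arc_relM u v g h : arc_rel u g -> arc_rel v h -> arc_rel (u * v) (g * h).
Proof.
move=> [n [f [-> fg]]] [k [r [-> rh]]]; exists (n + k)%N, (f * r); split.
  by rewrite (tofracM f r) exprD invfM [LHS]mulrACA.
by rewrite (rmorphM _ f r) /= fg rh exprD mulrACA.
Qed.

Lemma arc_rel_poly f : arc_rel f%:F (arc f).
Proof. by exists 0%N, f; rewrite expr0 divr1 mul1r. Qed.

Lemma X44_arc u : X44_set u -> exists2 g, const_mod4 g & arc_rel u g.
Proof.
pose S : set K := [set u | exists2 g, const_mod4 g & arc_rel u g].
move=> h; apply: (h S); split=> /=.
  split=> [|v w [g gP vg] [h' hP wh]|v w [g gP vg] [h' hP wh]].
  - exists 1; first by rewrite -polyC1; exact: const_mod4C.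
    by have := arc_rel_poly 1; rewrite !rmorph1.
  - exists (g - h'); last exact: arc_relB.
    by have [] := const_mod4_subring gP hP.
  - exists (g * h'); last exact: arc_relM.
    by have [] := const_mod4_subring gP hP.
move=> v [[f finv <-]|[r rI <-]].
  by exists (arc f); [exact: arc_invariants|exact: arc_rel_poly].
have [g gP rg] := arc_sing_ideal rI; exists g => //.
by exists 1%N, r; rewrite !expr1.
Qed.

Lemma X44_arc_val (a : X44 R) : exists g, const_mod4 g /\ arc_rel (X44_val a) g.
Proof.
have /asboolP/X44_arc[g gP ag] : X44_val a \in @X44_pred R by exact: valP.
by exists g.
Qed.

Definition chi (a : X44 R) : {poly C} := sval (cid (X44_arc_val a)).

Lemma chiP a : const_mod4 (chi a) /\ arc_rel (X44_val a) (chi a).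
Proof. exact: svalP (cid (X44_arc_val a)). Qed.

Lemma chiE a g : arc_rel (X44_val a) g -> chi a = g.
Proof. exact: arc_rel_inj (chiP a).2. Qed.

Lemma chi_zmod : zmod_morphism chi.
Proof. by move=> a b; apply: chiE; exact: arc_relB (chiP a).2 (chiP b).2. Qed.

Lemma chi_monoid : monoid_morphism chi.
Proof.
split; last by move=> a b; apply: chiE; exact: arc_relM (chiP a).2 (chiP b).2.
by apply: chiE; have := arc_rel_poly 1; rewrite !rmorph1.
Qed.

HB.instance Definition _ := GRing.isZmodMorphism.Build (X44 R) {poly C} chi chi_zmod.
HB.instance Definition _ := GRing.isMonoidMorphism.Build (X44 R) {poly C} chi chi_monoid.

(** A homogeneous fraction of positive degree has no constant term along the arc,
    and the values of [chi] are constants modulo s^4. *)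
Lemma chi_pos_homog (a : X44 R) : pos_homog (X44_val a) -> 'X^4 %| chi a.
Proof.
move=> [f [g [d [e [hf hg g0 ed aE]]]]].
have [[c [h chih]] [n [f1 [aE1 f1E]]]] := chiP a.
have fg : f1 * g = f * R44 R ^+ n.
  apply/eqP; rewrite -tofrac_eq (tofracM f1) (tofracM f) tofracXn -eqr_div ?tofrac_eq0 //.
    by rewrite -aE1 aE.
  by rewrite expf_neq0 ?R44_neq0.
have hR := R44_homog R.
(* the right-hand side is homogeneous of degree d + 8 n, and e < d *)
have f1_low j : (j <= 8 * n)%N -> pihomog mdeg j f1 = 0.
  move=> jn; apply: (mulIf g0); rewrite mul0r -(pihomogM _ _ hg) fg.
  apply: (@pihomog_ne0 _ _ _ (d + 8 * n)%N); last first.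
    by rewrite dhomogM // dhomogMn.
  by rewrite neq_ltn orbC (leq_ltn_trans (leq_add jn (leqnn e))) // addnC ltn_add2r.
(* so arc f1 vanishes to higher order than the power of the arc of R_{4,4} by
   which it is divided *)
have : 'X^((8 * n).+1) %| arc f1.
  rewrite arc_sum; elim/big_ind: _ => [|p q|j _]; first exact: dvdp0.
    exact: dvdp_add.
  have [/f1_low ->|lt] := leqP j (8 * n).
    by rewrite /on_plane rmorph0 comp_poly0 mulr0 dvdp0.
  by rewrite dvdp_mulr // dvdp_exp2l.
rewrite f1E arc_R44 exprMn -exprM exprS mulrC -mulrA.
rewrite dvdp_mul2l ?expf_neq0 ?polyX_eq0 //.
rewrite -[X in X %| _]subr0 -polyC0 dvdp_XsubCl rootM rootE horner_exp expf_eq0.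
rewrite (negPf (qpoly_sqr_eta0 R)) andbF /= rootE chih !hornerE /=.
rewrite ?expr0n ?mul0r ?addr0 => /eqP ->.
by rewrite polyC0 add0r dvdp_mulIl.
Qed.

End ChartArc.

(** * The square of the sextic lies in the cube of the maximal ideal *)

Section Chart.
Variable R : realType.
Local Notation C := R[i].
Local Notation CW := {mpoly C[4]}.
Local Notation K := {fraction CW}.
Local Notation "f %:F" := (tofrac f).
Local Notation m0 := (@X44_origin R).
Implicit Types (a b : C) (f r : CW).

Lemma X44_inv f : invariants f -> f%:F \in @X44_pred R.
Proof. by move=> fi; apply/asboolP => A [_ GA]; apply: GA; left; exists f. Qed.

Lemma X44_frac r : sing_ideal r -> r%:F / (R44 R)%:F \in @X44_pred R.
Proof. by move=> rI; apply/asboolP => A [_ GA]; apply: GA; right; exists r. Qed.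

Lemma origin_pos_homog (u : X44 R) : pos_homog (X44_val u) -> m0 u.
Proof. by move=> hu; exists 1%N, (fun=> u); rewrite big_ord1. Qed.

Lemma origin_inv d f (fi : invariants f) : f \is d.-homog -> (0 < d)%N ->
  m0 (MkX44 (X44_inv fi)).
Proof.
move=> hf d0; apply: origin_pos_homog; exists f, 1, d, 0%N.
by split; rewrite ?oner_neq0 ?dhomog1 //= rmorph1 divr1.
Qed.

Lemma origin_frac d r (rI : sing_ideal r) : r \is d.-homog -> (8 < d)%N ->
  m0 (MkX44 (X44_frac rI)).
Proof.
move=> hr d8; apply: origin_pos_homog; exists r, (R44 R), d, 8%N.
split=> //; first exact: R44_homog.
by have := R44_neq0 R; rewrite tofrac_eq0.
Qed.

Lemma invariants_const (c : C) : invariants (c%:MP : CW).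
Proof. by move=> g _; exact: act_polyC. Qed.

Lemma chi_origin u : m0 u -> 'X^4 %| chi u.
Proof.
move=> [n [c [hc ->]]]; rewrite rmorph_sum /=.
by elim/big_ind: _ => [|p q|i _]; [exact: dvdp0|exact: dvdp_add|exact: chi_pos_homog].
Qed.

Lemma chi_inv f (fi : invariants f) : chi (MkX44 (X44_inv fi)) = arc f.
Proof. by apply: chiE; exact: arc_rel_poly. Qed.

Lemma xi0_neq0 : xi0 R != 0.
Proof. by rewrite sqrtC_eq0 oppr_eq0 neq0Ci. Qed.

(** The form xX + yY becomes s^2 (eta^2 + i) = s^4 (2 xi0 + s^2). *)
Lemma arc_pairing : (arc (pairing R))`_4 != 0.
Proof.
have [ax ay aX aY] := arc_coord R.
have -> : arc (pairing R) = 'X^4 * ((2%:R * xi0 R)%:P + 'X^2).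
  rewrite /pairing rmorphD /= !(rmorphM (@arc R)) /= ax ay aX aY /eta -mul_polyC.
  have x2 : (xi0 R)%:P ^+ 2 = - ('i : C)%:P by rewrite -polyC_exp xi0_sqr polyCN.
  by rewrite polyCM polyC_natr; ring : x2.
rewrite coefXnM ltnn subnn coefD coefC coefXn addr0.
by rewrite mulf_neq0 ?xi0_neq0 // pnatr_eq0.
Qed.

(** The order is 6, as the sextic does not vanish at (xi0, 1). *)
Lemma arc_sextic_V : ~~ ('X^8 %| arc (sextic_V R)).
Proof.
have [ax ay _ _] := arc_coord R.
have -> : arc (sextic_V R) = 'X^6 * sextic (eta R) 1.
  transitivity (sextic (arc (coord_x R)) (arc (coord_y R))); first exact: pull_sextic.
  by rewrite ax ay /sextic; ring.
rewrite -[8%N]/(6 + 2)%N exprD dvdp_mul2l ?expf_neq0 ?polyX_eq0 //.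
apply/negP => /(dvdp_trans (dvdp_mulIl 'X 'X)).
rewrite -['X]subr0 -polyC0 dvdp_XsubCl rootE -[_.[0]]/(horner_eval 0 _).
rewrite (rmorph_sextic (horner_eval 0)) /= /horner_eval horner_eta0 hornerC.
have -> : sextic (xi0 R) 1 = - 2%:R * xi0 R.
  have i2 := iC2 R; have x2 := xi0_sqr R; rewrite /sextic; ring : x2 i2.
by rewrite mulf_eq0 oppr_eq0 pnatr_eq0 (negPf xi0_neq0).
Qed.

Lemma ideal_exp3 (u v w : X44 R) : m0 u -> m0 v -> m0 w -> ideal_exp m0 3 (u * v * w).
Proof.
move=> hu hv hw; apply: (@ideal_expD _ m0 2 1) (ideal_exp1 hw).
by apply: (@ideal_expD _ m0 1 1); exact: ideal_exp1.
Qed.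

(** With u = F0 F1 F2 / R, p = F2^3 / R and e = F0^2 G0 G2 / R, and their
    conjugates, the elements of the maximal ideal below are homogeneous of degrees
    4, 4 and 8. *)
Lemma sextic_V_sqr : ideal_exp m0 3 (MkX44 (X44_inv (@invariants_sextic_V R)) ^+ 2).
Proof.
have a2 := i_sqrt3_sqr R; set a := i_sqrt3 R in a2.
have [b ab] : exists b, b = - a by exists (- a).
have b2 : b ^+ 2 = - 3%:R by rewrite ab sqrrN.
have ba : a = - b by rewrite ab opprK.
have RE : R44 R = Phi2 a * Phi2 b by rewrite R44E ab.
have I012 (c : C) (c2 : c ^+ 2 = - 3%:R) := sing_ideal_Phi2 c2 (invariants_012 c2).
have I222 (c : C) (c2 : c ^+ 2 = - 3%:R) := sing_ideal_Phi2 c2 (invariants_cube c2).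
have Iab := sing_ideal_Phi2 b2 (invariants_0002 a2 b2 ab).
have Iba := sing_ideal_Phi2 a2 (invariants_0002 b2 a2 ba).
pose u (c : C) c2 : X44 R := MkX44 (X44_frac (I012 c c2)).
pose p (c : C) c2 : X44 R := MkX44 (X44_frac (I222 c c2)).
pose eab : X44 R := MkX44 (X44_frac Iab); pose eba : X44 R := MkX44 (X44_frac Iba).
pose z : X44 R := MkX44 (X44_inv (@invariants_pairing R)).
pose t : X44 R := MkX44 (X44_inv (@invariants_sextic_V R)).
pose k : X44 R := MkX44 (X44_inv (invariants_const (- 108%:R^-1))).
have mu c c2 : m0 (u c c2).
  exact: (origin_frac _ (dhomogM (Phi2_homog c) (dhomogM (Phi0_homog c) (Phi1_homog c)))).
have mp c c2 : m0 (p c c2).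
  exact: (origin_frac _ (dhomogM (Phi2_homog c) (dhomogM (Phi2_homog c) (Phi2_homog c)))).
have mab : m0 eab.
  exact: (origin_frac _ (dhomogM (Phi2_homog b)
    (dhomogM (Phi0_homog a) (dhomogM (Phi0_homog a) (Phi0_homog b))))).
have mba : m0 eba.
  exact: (origin_frac _ (dhomogM (Phi2_homog a)
    (dhomogM (Phi0_homog b) (dhomogM (Phi0_homog b) (Phi0_homog a))))).
have mz : m0 z.
  have [hx hy hX hY] := coord_homog R.
  exact: (origin_inv _ (dhomog_pairing hx hy hX hY)).
have -> : t ^+ 2 = k * (u a a2 * u a a2 * p b b2 + u b b2 * u b b2 * p a a2
    - (z * z * eab + z * z * eba)).
  apply: val_inj; rewrite expr2.
  have n108 : - 108%:R * ((- 108%:R^-1 : C)%:MP) = 1 :> CW.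
    have -> : - 108%:R = (- 108%:R : C)%:MP :> CW.
      by rewrite mpolyCN; congr (- _); exact/esym/(rmorph_nat (@mpolyC 4 C)).
    by rewrite -mpolyCM mulrNN mulfV ?pnatr_eq0 // mpolyC1.
  exact: (frac_sqr_cubic RE (R44_neq0 R) (Phi_hessian a2 ab) (Phi_hessian b2 ba)
    (Phi_cubes a2 ab) n108).
have [_ D M] := ideal_exp_ideal m0 3.
apply: M; apply: (ideal_sub (ideal_exp_ideal m0 3)).
  by apply: D; exact: ideal_exp3.
by apply: D; exact: ideal_exp3.
Qed.

End Chart.

Theorem mainTheorem3 (R : realType) :
  ~ Proj_is_reduced (assoc_graded (@X44_origin R)).
Proof.
have [hx hy hX hY] := coord_homog R.
have mz := origin_inv (@invariants_pairing R) (dhomog_pairing hx hy hX hY) isT.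
have mt := origin_inv (@invariants_sextic_V R) (dhomog_sextic hx hy) isT.
pose ch : {rmorphism X44 R -> {poly R[i]}} := @chi R.
apply: (@Proj_gr_not_reduced _ _ _ ch 4 _ _ _ mz _ _ mt (@sextic_V_sqr R)).
- exact: chi_origin.
- by [].
- by rewrite /ch /= chi_inv arc_pairing.
- by rewrite /ch /= chi_inv arc_sextic_V.
Qed.
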